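(* Let $d=1$ and let $m=2\ell\ge 3$ be odd. Then $\operatorname{LocDer}\mathfrak g_\ell(1)$ is a Lie algebra under the commutator of endomorphisms. More precisely, $$\operatorname{LocDer}\mathfrak g_\ell(1)=\operatorname{Der}\mathfrak g_\ell(1)\ltimes\mathcal P_m,\qquad [\mathcal P_m,\mathcal P_m]=0,$$ where $\mathcal P_m\cong U_{m-2}$ is an abelian ideal. Equivalently, $$\operatorname{LocDer}\mathfrak g_\ell(1)\cong\bigl(\mathfrak{sl}_2(\mathbb C)\oplus\mathbb C d_0\bigr)\ltimes\bigl(U_m\oplus U_{m-2}\bigr),$$ where $d_0$ commutes with $\mathfrak{sl}_2(\mathbb C)$ and acts as the identity on both $U_m$ and $U_{m-2}$ (and $U_m\oplus U_{m-2}$ is an abelian ideal carrying the $\mathfrak{sl}_2(\mathbb C)$-module structure of the two irreducible modules).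
   Context: Everything is over $\mathbb C$. For a Lie algebra $L$, a linear map $\Delta:L\to L$ is a local derivation if for every $x\in L$ there is a derivation $D_x\in\operatorname{Der}L$ with $\Delta(x)=D_x(x)$; $\operatorname{LocDer}L$ is the set of local derivations. $U_j$ denotes the irreducible $\mathfrak{sl}_2(\mathbb C)$-module of highest weight $j$ (dimension $j+1$). With $m=2\ell$, the conformal Galilei algebra in spatial dimension one is $\mathfrak g_\ell(1)=\mathfrak{sl}_2(\mathbb C)\ltimes U_m$, where $\mathfrak{sl}_2=\operatorname{span}\{e,f,h\}$ with $[h,e]=2e$, $[h,f]=-2f$, $[e,f]=h$, the ideal $U_m=\operatorname{span}\{u_0,\dots,u_m\}$ is abelian, and $$[h,u_k]=(m-2k)u_k,\quad [e,u_k]=ku_{k-1},\quad [f,u_k]=(m-k)u_{k+1},\qquad u_{-1}=u_{m+1}=0.$$ With the action $(a\cdot F)(x)=[a,F(x)]-F([a,x])$, the module $\operatorname{Hom}(\mathfrak{sl}_2,U_m)$ decomposes as $U_{m+2}\oplus U_m\oplus U_{m-2}$. $\mathcal P_m$ is the set of linear maps $\mathfrak g_\ell(1)\to\mathfrak g_\ell(1)$ obtained from the elements of the $U_{m-2}$-summand by extending them by zero on $U_m$. *)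

(* Defs.v *)
From HB Require Import structures.
From mathcomp Require Import all_boot all_order all_algebra.
From mathcomp Require Import boolp classical_sets reals.
From mathcomp Require Import complex ring.

Set Implicit Arguments.
Unset Strict Implicit.
Unset Printing Implicit Defensive.

Import GRing.Theory.
Local Open Scope ring_scope.
Local Open Scope classical_set_scope.

HB.mixin Record isLieAlgebra (F : fieldType) L of Vector F L := {
  lie : L -> L -> L;
  lie_linearl : forall y, linear (fun x => lie x y);
  lie_linearr : forall x, linear (lie x);
  liexx : forall x, lie x x = 0;
  lie_jacobi : forall x y z,
    lie x (lie y z) + lie y (lie z x) + lie z (lie x y) = 0
}.

#[short(type="lieType")]
HB.structure Definition LieAlgebra (F : fieldType) :=
  {L of Vector F L & isLieAlgebra F L}.

Notation "[lie x , y ]" := (lie x y)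
  (at level 0, x, y at level 99, format "[lie  x ,  y ]") : ring_scope.

Section LieTheory.
Variables (F : fieldType) (L : lieType F).
Implicit Types x y z : L.

HB.instance Definition _ x := GRing.isLinear.Build F L L *:%R (lie x) (lie_linearr x).

Lemma lieDr x y z : [lie x, y + z] = [lie x, y] + [lie x, z].
Proof. exact: linearD. Qed.

Lemma lieZr a x y : [lie x, a *: y] = a *: [lie x, y].
Proof. exact: linearZ. Qed.

Lemma lieDl x y z : [lie x + y, z] = [lie x, z] + [lie y, z].
Proof. by have := lie_linearl z 1 x y; rewrite !scale1r. Qed.

Lemma lie0l y : [lie 0, y] = 0.
Proof. by have /eqP := lieDl 0 0 y; rewrite addr0 -subr_eq subrr eq_sym => /eqP. Qed.

Lemma lie0r x : [lie x, 0] = 0.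
Proof. exact: linear0. Qed.

Lemma lieZl a x y : [lie a *: x, y] = a *: [lie x, y].
Proof. by have := lie_linearl y a x 0; rewrite !addr0 lie0l addr0. Qed.

Lemma lie_anti x y : [lie x, y] = - [lie y, x].
Proof.
apply/eqP; rewrite -addr_eq0; apply/eqP.
by have := liexx (x + y); rewrite lieDl !lieDr !liexx add0r addr0.
Qed.

Definition ad x : 'End(L) := linfun (lie x).

Lemma adE x y : ad x y = [lie x, y].
Proof. by rewrite lfunE. Qed.

Definition subspace (S : set L) : Prop :=
  S 0 /\ forall a x y, S x -> S y -> S (a *: x + y).

Definition lie_subalgebra (S : set L) : Prop :=
  subspace S /\ forall x y, S x -> S y -> S [lie x, y].

Definition lie_ideal (S I : set L) : Prop :=
  [/\ subspace I, I `<=` S & forall x y, S x -> I y -> I [lie x, y]].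

Definition lie_commutative (S : set L) : Prop :=
  forall x y, S x -> S y -> [lie x, y] = 0.

Definition internal_semidirect (S A I : set L) : Prop :=
  [/\ lie_subalgebra S, lie_subalgebra A, lie_ideal S I,
      A `&` I = [set 0] & S = [set a + i | a in A & i in I]].

End LieTheory.

Definition lie_isomorphic (F : fieldType) (L M : lieType F) (S : set M) : Prop :=
  exists phi : 'Hom(L, M),
    [/\ injective phi, range phi = S
      & forall x y, phi [lie x, y] = [lie phi x, phi y]].

Definition gl (F : fieldType) (V : vectType F) : Type := 'End(V).

Section Gl.
Variables (F : fieldType) (V : vectType F).
Implicit Types f g : 'End(V).

HB.instance Definition _ := Vector.copy (gl V) 'End(V).

Definition commutator f g : 'End(V) := ((f \o g) - (g \o f))%VF.

Lemma commutatorE f g v : commutator f g v = f (g v) - g (f v).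
Proof. by rewrite add_lfunE opp_lfunE !comp_lfunE. Qed.

Fact commutator_linearl g : linear (commutator^~ g).
Proof.
move=> a f f'; apply/lfunP => v.
rewrite /commutator !(add_lfunE, opp_lfunE, scale_lfunE, comp_lfunE).
by rewrite linearP scalerBr opprD addrACA.
Qed.

Fact commutator_linearr f : linear (commutator f).
Proof.
move=> a g g'; apply/lfunP => v.
rewrite /commutator !(add_lfunE, opp_lfunE, scale_lfunE, comp_lfunE).
by rewrite linearP scalerBr opprD addrACA.
Qed.

Fact commutatorxx f : commutator f f = 0.
Proof. exact: subrr. Qed.

Fact commutator_jacobi f g h :
  commutator f (commutator g h) + commutator g (commutator h f)
  + commutator h (commutator f g) = 0.
Proof.
apply/lfunP => v.
rewrite /commutator !(add_lfunE, opp_lfunE, zero_lfunE, comp_lfunE) !linearB.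
rewrite /= !opprK.
rewrite (AC ((2*2)*(2*2)*(2*2)) ((1*11)*(8*2)*(5*3)*(4*10)*(12*6)*(9*7))) /=.
by rewrite !subrr !addr0.
Qed.

HB.instance Definition _ := isLieAlgebra.Build F (gl V)
  commutator_linearl commutator_linearr commutatorxx commutator_jacobi.

End Gl.

Section Derivations.
Variables (F : fieldType) (L : lieType F).

Definition Der : set (gl L) :=
  [set D : 'End(L) | forall x y, D [lie x, y] = [lie D x, y] + [lie x, D y]].

Definition LocDer : set (gl L) :=
  [set Delta : 'End(L) | forall x, exists2 D : 'End(L), Der D & Delta x = D x].

End Derivations.

Arguments Der {F} L _.
Arguments LocDer {F} L _.

Record lieModule (F : fieldType) (L : lieType F) (V : vectType F) := LieModule {
  act :> L -> V -> V;
  act_linearl : forall v, linear (act^~ v);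
  act_linearr : forall x, linear (act x);
  act_lie : forall x y v, act [lie x, y] v = act x (act y v) - act y (act x v)
}.

Section ActTheory.
Variables (F : fieldType) (L : lieType F) (V : vectType F) (rho : lieModule L V).

HB.instance Definition _ x :=
  GRing.isLinear.Build F V V *:%R (rho x) (act_linearr rho x).

Lemma actDl x y v : rho (x + y) v = rho x v + rho y v.
Proof. by have := act_linearl rho v 1 x y; rewrite !scale1r. Qed.

Lemma actDr x v w : rho x (v + w) = rho x v + rho x w.
Proof. exact: linearD. Qed.

Lemma actZr x a v : rho x (a *: v) = a *: rho x v.
Proof. exact: linearZ. Qed.

Lemma actBr x v w : rho x (v - w) = rho x v - rho x w.
Proof. exact: linearB. Qed.

Lemma act0l v : rho 0 v = 0.
Proof.
by have /eqP := actDl 0 0 v; rewrite addr0 -subr_eq subrr eq_sym => /eqP.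
Qed.

Lemma actZl a x v : rho (a *: x) v = a *: rho x v.
Proof. by have := act_linearl rho v a x 0; rewrite !addr0 act0l addr0. Qed.

End ActTheory.

Definition semidirect (F : fieldType) (L : lieType F) (V : vectType F)
  (rho : lieModule L V) : Type := (L * V)%type.

Section Semidirect.
Variables (F : fieldType) (L : lieType F) (V : vectType F) (rho : lieModule L V).
Implicit Types p q r : (L * V)%type.

HB.instance Definition _ := Vector.copy (semidirect rho) (L * V)%type.

Definition semidirect_lie p q : (L * V)%type :=
  ([lie p.1, q.1], rho p.1 q.2 - rho q.1 p.2).

Fact semidirect_linearl q : linear (semidirect_lie^~ q).
Proof.
move=> a p p'; congr pair => /=; first exact: lie_linearl.
by rewrite act_linearl linearP opprD addrACA scalerBr.
Qed.

Fact semidirect_linearr p : linear (semidirect_lie p).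
Proof.
move=> a q q'; congr pair => /=; first exact: lie_linearr.
by rewrite act_linearl linearP opprD addrACA scalerBr.
Qed.

Fact semidirect_liexx p : semidirect_lie p p = 0.
Proof. by congr pair; rewrite /= ?liexx ?subrr. Qed.

Fact semidirect_jacobi p q r :
  semidirect_lie p (semidirect_lie q r) + semidirect_lie q (semidirect_lie r p)
  + semidirect_lie r (semidirect_lie p q) = 0.
Proof.
congr pair => /=; first exact: lie_jacobi.
rewrite !act_lie !actBr !opprB !addrA.
rewrite (ACl ((1*12)*(7*2)*(3*10)*(5*4)*(11*6)*(9*8))) /=.
by rewrite !subrr !addr0.
Qed.

HB.instance Definition _ := isLieAlgebra.Build F (semidirect rho)
  semidirect_linearl semidirect_linearr semidirect_liexx semidirect_jacobi.

Definition extend_by_zero (f : 'Hom(L, V)) : 'End(semidirect rho) :=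
  linfun (fun p : semidirect rho => (0, f p.1) : semidirect rho).

Fact extend_by_zero_subproof (f : 'Hom(L, V)) :
  linear (fun p : semidirect rho => (0, f p.1) : semidirect rho).
Proof. by move=> a p q; congr pair; rewrite /= ?scaler0 ?addr0 ?linearP. Qed.

Lemma extend_by_zeroE f p : extend_by_zero f p = (0, f p.1).
Proof.
pose Ml := GRing.isLinear.Build _ _ _ _ _ (extend_by_zero_subproof f).
pose l : {linear _ -> _} := HB.pack (fun p : semidirect rho => (0, f p.1) : semidirect rho) Ml.
exact: (lfunE l).
Qed.

End Semidirect.

Section SumModule.
Variables (F : fieldType) (L : lieType F) (V W : vectType F).
Variables (rho : lieModule L V) (sigma : lieModule L W).

Definition sum_act (x : L) (p : (V * W)%type) : (V * W)%type :=
  (rho x p.1, sigma x p.2).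

Fact sum_act_linearl p : linear (sum_act^~ p).
Proof. by move=> a x y; congr pair; rewrite /= act_linearl. Qed.

Fact sum_act_linearr x : linear (sum_act x).
Proof. by move=> a p q; congr pair; rewrite /= act_linearr. Qed.

Fact sum_act_lie x y p :
  sum_act [lie x, y] p = sum_act x (sum_act y p) - sum_act y (sum_act x p).
Proof. by congr pair; rewrite /= act_lie. Qed.

Definition sum_module : lieModule L (V * W)%type :=
  LieModule sum_act_linearl sum_act_linearr sum_act_lie.

End SumModule.

Section HomModule.
Variables (F : fieldType) (L : lieType F) (V : vectType F) (rho : lieModule L V).
Implicit Types (x y : L) (f : 'Hom(L, V)).

Definition hom_act x f : 'Hom(L, V) := linfun (fun y => rho x (f y) - f [lie x, y]).

Fact hom_act_subproof x f : linear (fun y => rho x (f y) - f [lie x, y]).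
Proof.
move=> a y z; rewrite (linearP f) (lie_linearr x) (linearP f) act_linearr.
by rewrite opprD addrACA scalerBr.
Qed.

Lemma hom_actE x f y : hom_act x f y = rho x (f y) - f [lie x, y].
Proof.
pose Ml := GRing.isLinear.Build _ _ _ _ _ (hom_act_subproof x f).
pose l : {linear _ -> _} := HB.pack (fun y => rho x (f y) - f [lie x, y]) Ml.
exact: (lfunE l).
Qed.

Fact hom_act_linearl f : linear (hom_act^~ f).
Proof.
move=> a x y; apply/lfunP => z.
rewrite add_lfunE scale_lfunE !hom_actE act_linearl lie_linearl (linearP f) /=.
by rewrite opprD addrACA scalerBr.
Qed.

Fact hom_act_linearr x : linear (hom_act x).
Proof.
move=> a f g; apply/lfunP => z.
rewrite !(add_lfunE, scale_lfunE, hom_actE) act_linearr.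
by rewrite opprD addrACA scalerBr.
Qed.

Fact hom_act_lie x y f :
  hom_act [lie x, y] f = hom_act x (hom_act y f) - hom_act y (hom_act x f).
Proof.
apply/lfunP => z; rewrite !(add_lfunE, opp_lfunE, hom_actE) act_lie !actBr.
have -> : [lie [lie x, y], z] = [lie x, [lie y, z]] - [lie y, [lie x, z]].
  have /eqP := lie_jacobi x y z; rewrite addr_eq0 => /eqP E.
  rewrite [LHS]lie_anti -E.
  by rewrite [ [lie z, x] ]lie_anti linearN.
rewrite linearB !opprB [RHS]addrA [RHS](AC ((2*2)*2*2) ((1*8)*(3*6)*(5*2)*(7*4))) /=.
by rewrite !subrr !addr0.
Qed.

Definition hom_module : lieModule L 'Hom(L, V) :=
  LieModule hom_act_linearl hom_act_linearr hom_act_lie.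

End HomModule.

Definition module_hom (F : fieldType) (L : lieType F) (V W : vectType F)
  (rho : lieModule L V) (sigma : lieModule L W) (phi : 'Hom(V, W)) : Prop :=
  forall x v, phi (rho x v) = sigma x (phi v).

(** L (+) F d0, where d0 = (0, 1) commutes with L *)
Definition add_central (F : fieldType) (L : lieType F) : Type := (L * F^o)%type.

Section AddCentral.
Variables (F : fieldType) (L : lieType F).
Implicit Types p q r : (L * F^o)%type.

HB.instance Definition _ := Vector.copy (add_central L) (L * F^o)%type.

Definition add_central_lie p q : (L * F^o)%type := ([lie p.1, q.1], 0).

Fact add_central_linearl q : linear (add_central_lie^~ q).
Proof.
by move=> a p p'; congr pair; rewrite /= ?scaler0 ?addr0 ?lie_linearl.
Qed.

Fact add_central_linearr p : linear (add_central_lie p).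
Proof.
by move=> a q q'; congr pair; rewrite /= ?scaler0 ?addr0 ?lie_linearr.
Qed.

Fact add_central_liexx p : add_central_lie p p = 0.
Proof. by congr pair; rewrite /= liexx. Qed.

Fact add_central_jacobi p q r :
  add_central_lie p (add_central_lie q r)
  + add_central_lie q (add_central_lie r p)
  + add_central_lie r (add_central_lie p q) = 0.
Proof. by congr pair; rewrite /= ?addr0 ?lie_jacobi. Qed.

HB.instance Definition _ := isLieAlgebra.Build F (add_central L)
  add_central_linearl add_central_linearr add_central_liexx add_central_jacobi.

Variables (V : vectType F) (rho : lieModule L V).

(** d0 acts as the identity *)
Definition add_central_act (p : add_central L) (v : V) : V :=
  rho p.1 v + p.2 *: v.

Fact add_central_act_linearl v : linear (add_central_act^~ v).
Proof.
move=> a p q; rewrite /add_central_act /= act_linearl scalerDl scalerDr addrACA.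
by rewrite scalerA.
Qed.

Fact add_central_act_linearr p : linear (add_central_act p).
Proof.
move=> a v w; rewrite /add_central_act act_linearr !scalerDr addrACA.
by rewrite !scalerA mulrC.
Qed.

Fact add_central_act_lie (p q : add_central L) v :
  add_central_act [lie p, q] v =
  add_central_act p (add_central_act q v) - add_central_act q (add_central_act p v).
Proof.
rewrite /add_central_act /= scale0r addr0 act_lie !actDr !actZr !scalerDr !scalerA.
rewrite [q.2 * p.2]mulrC !opprD.
rewrite (AC ((2*2)*(2*2)) ((1*5)*(2*7)*(3*6)*(4*8))) /=.
by rewrite !subrr !addr0.
Qed.

Definition add_central_module : lieModule (add_central L) V :=
  LieModule add_central_act_linearl add_central_act_linearr add_central_act_lie.

End AddCentral.

(** Coordinates on the basis e, f, h *)
Definition sl2 (F : fieldType) : Type := 'rV[F]_3.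

Section Sl2.
Variable F : fieldType.
Implicit Types x y z : 'rV[F]_3.

HB.instance Definition _ := Vector.copy (sl2 F) 'rV[F]_3.

Definition sl2_e : sl2 F := delta_mx 0 0.
Definition sl2_f : sl2 F := delta_mx 0 1.
Definition sl2_h : sl2 F := delta_mx 0 2%:R.

Definition sl2_lie x y : 'rV[F]_3 :=
  (2%:R * (x 0 2%:R * y 0 0 - x 0 0 * y 0 2%:R)) *: sl2_e
  - (2%:R * (x 0 2%:R * y 0 1 - x 0 1 * y 0 2%:R)) *: sl2_f
  + (x 0 0 * y 0 1 - x 0 1 * y 0 0) *: sl2_h.

Fact sl2_linearl y : linear (sl2_lie^~ y).
Proof. by move=> t x z; apply/rowP => i; rewrite !mxE; ring. Qed.

Fact sl2_linearr x : linear (sl2_lie x).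
Proof. by move=> t y z; apply/rowP => i; rewrite !mxE; ring. Qed.

Fact sl2_liexx x : sl2_lie x x = 0.
Proof. by apply/rowP => i; rewrite !mxE; ring. Qed.

Fact sl2_jacobi x y z :
  sl2_lie x (sl2_lie y z) + sl2_lie y (sl2_lie z x) + sl2_lie z (sl2_lie x y) = 0.
Proof. by apply/rowP => i; rewrite !mxE /=; ring. Qed.

HB.instance Definition _ := isLieAlgebra.Build F (sl2 F)
  sl2_linearl sl2_linearr sl2_liexx sl2_jacobi.

Lemma sl2_he : [lie sl2_h, sl2_e] = 2%:R *: sl2_e.
Proof. by apply/rowP => i; rewrite !mxE /=; ring. Qed.

Lemma sl2_hf : [lie sl2_h, sl2_f] = - (2%:R *: sl2_f).
Proof. by apply/rowP => i; rewrite !mxE /=; ring. Qed.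

Lemma sl2_ef : [lie sl2_e, sl2_f] = sl2_h.
Proof. by apply/rowP => i; rewrite !mxE /=; ring. Qed.

(** This is u_k for k <= m, and 0 for k > m; u_(-1) only ever occurs with
    coefficient 0, so its encoding as u_0 is harmless *)
Definition U_basis (m k : nat) : 'rV[F]_m.+1 := \row_i (i == k :> nat)%:R.

Definition U_basis_act (m : nat) x (k : nat) : 'rV[F]_m.+1 :=
  x 0 0 *: (k%:R *: U_basis m k.-1)
  + x 0 1 *: ((m - k)%:R *: U_basis m k.+1)
  + x 0 2%:R *: ((m%:R - 2%:R * k%:R) *: U_basis m k).

Definition U_act (m : nat) (x : sl2 F) (v : 'rV[F]_m.+1) : 'rV[F]_m.+1 :=
  \sum_(k < m.+1) v 0 k *: U_basis_act m x k.

Fact U_act_linearl m (v : 'rV_m.+1) : linear (@U_act m ^~ v).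
Proof.
move=> a x y; rewrite /U_act scaler_sumr -big_split /=; apply: eq_bigr => k _.
by apply/rowP => i; rewrite !mxE; ring.
Qed.

Fact U_act_linearr m x : linear (@U_act m x).
Proof.
move=> a v w; rewrite /U_act scaler_sumr -big_split /=; apply: eq_bigr => k _.
by rewrite !mxE scalerDl scalerA.
Qed.

HB.instance Definition _ m x :=
  GRing.isLinear.Build F _ _ *:%R (@U_act m x) (@U_act_linearr m x).

Lemma U_act_basis m x k : (k <= m)%N -> U_act x (U_basis m k) = U_basis_act m x k.
Proof.
move=> km; rewrite /U_act (bigD1 (Ordinal (km : (k < m.+1)%N))) //= mxE eqxx scale1r.
rewrite big1 ?addr0 // => i; rewrite -val_eqE /= mxE => /negPf ->.
by rewrite scale0r.
Qed.

Lemma U_basisE m (v : 'rV[F]_m.+1) : v = \sum_(k < m.+1) v 0 k *: U_basis m k.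
Proof.
apply/rowP => i; rewrite summxE (bigD1 i) //= !mxE eqxx mulr1.
rewrite big1 ?addr0 // => k; rewrite -val_eqE /= !mxE eq_sym => /negPf ->.
by rewrite mulr0.
Qed.

Lemma eq_on_U_basis m (V : lmodType F) (f g : {linear 'rV[F]_m.+1 -> V}) :
  (forall k, (k <= m)%N -> f (U_basis m k) = g (U_basis m k)) -> f =1 g.
Proof.
move=> fg v; rewrite (U_basisE v) !linear_sum; apply: eq_bigr => k _.
by rewrite !linearZ /= fg // -ltnS.
Qed.

Fact U_act_lie m (x y : sl2 F) (v : 'rV[F]_m.+1) :
  U_act [lie x, y] v = U_act x (U_act y v) - U_act y (U_act x v).
Proof.
pose f : {linear 'rV[F]_m.+1 -> 'rV[F]_m.+1} := @U_act m [lie x, y].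
pose g : {linear 'rV[F]_m.+1 -> 'rV[F]_m.+1} :=
  (@U_act m x \o @U_act m y) \- (@U_act m y \o @U_act m x).
apply: (eq_on_U_basis (f := f) (g := g)) v => k km; rewrite /f /g /= {f g}.
have E z : k%:R *: U_act z (U_basis m k.-1) = k%:R *: U_basis_act m z k.-1.
  by case: k km => [|k] km; rewrite ?scale0r // U_act_basis // ltnW.
have G z : (m - k)%:R *: U_act z (U_basis m k.+1) = (m - k)%:R *: U_basis_act m z k.+1.
  case: (ltnP k m) => [lkm|]; first by rewrite U_act_basis.
  by rewrite -subn_eq0 => /eqP ->; rewrite !scale0r.
have H z t : U_act z (U_basis_act m t k) =
    t 0 0 *: (k%:R *: U_basis_act m z k.-1)
    + t 0 1 *: ((m - k)%:R *: U_basis_act m z k.+1)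
    + t 0 2%:R *: ((m%:R - 2%:R * k%:R) *: U_basis_act m z k).
  have aD v w : U_act z (v + w) = U_act z v + U_act z w by exact: linearD.
  have aZ a v : U_act z (a *: v) = a *: U_act z v by exact: linearZ.
  by rewrite -E -G -(U_act_basis z km) {1}/U_basis_act !aD !aZ.
rewrite !U_act_basis // !H /U_basis_act; apply/rowP => i; rewrite !mxE /=.
move: (nat_of_ord i) => {}i.
have [d md] : exists d, m = (k + d)%N by exists (m - k)%N; rewrite subnKC.
rewrite md {E G H km md} addKn; case: k => [|k] /=.
  by rewrite add0n; case: d => [|d]; rewrite ?subSS ?subn0; ring.
rewrite !addSn -addnS addKn.
by case: d => [|d]; rewrite ?subnn ?addnS ?subSS ?addKn; ring.
Qed.

Definition U m : lieModule (sl2 F) 'rV[F]_m.+1 :=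
  LieModule (@U_act_linearl m) (@U_act_linearr m) (@U_act_lie m).

Lemma U_e m k : (k <= m)%N -> U m sl2_e (U_basis m k) = k%:R *: U_basis m k.-1.
Proof.
by move=> km; rewrite /= U_act_basis //; apply/rowP => i; rewrite !mxE /=; ring.
Qed.

Lemma U_f m k :
  (k <= m)%N -> U m sl2_f (U_basis m k) = (m - k)%:R *: U_basis m k.+1.
Proof.
by move=> km; rewrite /= U_act_basis //; apply/rowP => i; rewrite !mxE /=; ring.
Qed.

Lemma U_h m k :
  (k <= m)%N -> U m sl2_h (U_basis m k) = (m%:R - 2%:R * k%:R) *: U_basis m k.
Proof.
by move=> km; rewrite /= U_act_basis //; apply/rowP => i; rewrite !mxE /=; ring.
Qed.

End Sl2.

(** The conformal Galilei algebra in spatial dimension one, where m = 2 l *)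
Definition galilei (F : fieldType) (m : nat) : lieType F := semidirect (U F m).

Definition galilei_sl2 (F : fieldType) (m : nat) (a : sl2 F) : galilei F m :=
  (a, 0).

Definition hom_decomposition (F : fieldType) (m : nat)
    (Phi : 'Hom(('rV[F]_(m + 2).+1 * 'rV[F]_m.+1 * 'rV[F]_(m - 2).+1)%type,
                'Hom(sl2 F, 'rV[F]_m.+1))) : Prop :=
  module_hom (sum_module (sum_module (U F (m + 2)) (U F m)) (U F (m - 2)))
    (hom_module (U F m)) Phi /\ bijective Phi.

(** The three summands are pairwise non-isomorphic in characteristic 0, so that
    the image of U_(m-2) does not depend on Phi *)
Definition hom_summand (F : fieldType) (m : nat) : set 'Hom(sl2 F, 'rV[F]_m.+1) :=
  [set f | exists2 Phi, hom_decomposition Phi & exists w, f = Phi (0, 0, w)].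

Arguments hom_summand : clear implicits.

Definition calP (F : fieldType) (m : nat) : set (gl (galilei F m)) :=
  [set extend_by_zero (U F m) f | f in hom_summand F m].

Arguments calP : clear implicits.

(** The action of sl_2 on Hom(sl_2, U_m) becomes, after extension by zero, the
    commutator with the inner derivations ad (a, 0) *)
Lemma extend_by_zero_act (F : fieldType) (m : nat) (a : sl2 F)
    (f : 'Hom(sl2 F, 'rV[F]_m.+1)) :
  extend_by_zero (U F m) (hom_module (U F m) a f) =
  [lie ad (galilei_sl2 m a) : gl (galilei F m), extend_by_zero (U F m) f].
Proof.
apply/lfunP => p; rewrite [RHS]commutatorE !adE !extend_by_zeroE hom_actE.
congr pair.
  by rewrite -[RHS]/([lie a, 0 : sl2 F] - 0) lie0r subr0.
rewrite -[RHS]/(U F m a (f p.1) - U F m 0 0 - f [lie a, p.1]).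
by rewrite act0l subr0.
Qed.

(** S, stable under the commutator with ad (a, 0) for a in sl_2, is isomorphic
    to the sl_2-module rho *)
Definition sl2_isomorphic (F : fieldType) (m : nat) (V : vectType F)
    (rho : lieModule (sl2 F) V) (S : set (gl (galilei F m))) : Prop :=
  exists phi : 'Hom(V, gl (galilei F m)),
    [/\ injective phi, range phi = S
      & forall a v, phi (rho a v) =
          [lie ad (galilei_sl2 m a) : gl (galilei F m), phi v]].

Definition locder_model (F : fieldType) (m : nat) : lieType F :=
  semidirect (add_central_module (sum_module (U F m) (U F (m - 2)))).

(* Main.v *)
From HB Require Import structures.
Require Import Defs.
From mathcomp Require Import all_boot all_order all_algebra.
From mathcomp Require Import boolp classical_sets reals.
From mathcomp Require Import complex ring.

(** Identify [U_m] with the polynomials of degree at most [m] via [u_k = X^k];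
    then [a] in [sl_2] acts by [P |-> q P' - (m/2) q' P], where [q = quad a] is a
    polynomial of degree at most 2, and [U_(m-2)] embeds into [Hom(sl_2, U_m)] as
    [w |-> (a |-> q w)].  The three summands of [Hom(sl_2, U_m)] are the second
    transvectants of [q] with [W], the coboundaries of [P], and the products
    [q w].

    A local derivation is tested on the nilpotent elements with [q = (X - r)^2].
    On these [q P' - (m/2) q' P] vanishes at [r], while the component of a linear
    map [sl_2 -> U_m] in [U_(m+2)] takes at [r] a nonzero multiple of the value
    [W(r)], so that this component is zero.  In the same way the restriction to
    [U_m] is, up to an inner derivation, an endomorphism preserving the vanishing
    at [r] for every [r], hence a scalar.

    Conversely [a |-> q w] is a local derivation when [q P' - (m/2) q' P = q w] has
    a solution [P] for every [q].  If [q] has a simple root [r], the operator on the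
    left is injective, since a solution of the homogeneous equation would vanish at
    [r] to the order [m/2], which is not an integer.  Otherwise [q] is constant or a
    multiple of [(X - r)^2], and [q w] is in the image. *)

Set Implicit Arguments.
Unset Strict Implicit.
Unset Printing Implicit Defensive.

Import Order.TTheory GRing.Theory Num.Theory.
Local Open Scope ring_scope.
Local Open Scope classical_set_scope.

(** * Elements of sl_2 as quadratic vector fields on the line *)

Section Quad.
Variable F : fieldType.
Implicit Types (a b : sl2 F) (P W w : {poly F}).

(** The vector field [quad a] d/dX is the one by which [a] differentiates. The signs and the factor
    2 are forced by the action of [e], [f], [h] on [u_k = X^k]. *)
Definition quad a : {poly F} :=
  (a 0 0)%:P - 2%:R * (a 0 2%:R)%:P * 'X - (a 0 1)%:P * 'X^2.

(** Half the derivative of [quad a]; working with it avoids the factors 1/2. *)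
Definition dquad a : {poly F} := - (a 0 2%:R)%:P - (a 0 1)%:P * 'X.

Lemma quad_linear : linear quad.
Proof.
by move=> c a b; rewrite /quad !mxE -mul_polyC !(polyCD, polyCM); ring.
Qed.

Lemma dquad_linear : linear dquad.
Proof.
by move=> c a b; rewrite /dquad !mxE -mul_polyC !(polyCD, polyCM); ring.
Qed.

HB.instance Definition _ := GRing.isLinear.Build F _ _ *:%R quad quad_linear.
HB.instance Definition _ := GRing.isLinear.Build F _ _ *:%R dquad dquad_linear.

Lemma deriv_quad a : (quad a)^`() = 2%:R * dquad a.
Proof. by rewrite /quad /dquad !(derivE, derivM, derivC); ring. Qed.

Lemma deriv_dquad a : (dquad a)^`() = - (a 0 1)%:P.
Proof. by rewrite /dquad !derivE; ring. Qed.

(** This is the bracket of vector fields, that is, the Wronskian of the two quadratics. *)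
Lemma quad_lie a b :
  quad [lie a, b] = 2%:R * (quad a * dquad b - dquad a * quad b).
Proof.
by rewrite /quad /dquad /= !mxE /= !(polyCD, polyCB, polyCM, polyCN); ring.
Qed.

End Quad.

(** * The modules [U m] as tensor densities, and transvectants *)

Section Density.
Variable F : fieldType.
Implicit Types (a b : sl2 F) (P W w : {poly F}) (m n : nat).

Lemma quad_e : quad (sl2_e F) = 1.
Proof. by rewrite /quad !mxE /=; ring. Qed.

Lemma quad_f : quad (sl2_f F) = - 'X^2.
Proof. by rewrite /quad !mxE /=; ring. Qed.

Lemma quad_h : quad (sl2_h F) = - (2%:R * 'X).
Proof. by rewrite /quad !mxE /=; ring. Qed.

Lemma dquad_e : dquad (sl2_e F) = 0.
Proof. by rewrite /dquad !mxE /=; ring. Qed.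

Lemma dquad_f : dquad (sl2_f F) = - 'X.
Proof. by rewrite /dquad !mxE /=; ring. Qed.

Lemma dquad_h : dquad (sl2_h F) = - 1.
Proof. by rewrite /dquad !mxE /=; ring. Qed.

Lemma sl2_decomp a :
  a = a 0 0 *: sl2_e F + a 0 1 *: sl2_f F + a 0 2%:R *: sl2_h F.
Proof.
apply/rowP => i; rewrite !mxE /=.
by case: i => [[|[|[|//]]] p]; rewrite /= ?(mulr1, mulr0, addr0, add0r);
  congr (a _ _); apply: val_inj.
Qed.

Lemma size_quad a : (size (quad a) <= 3)%N.
Proof.
apply/leq_sizeP => j j3; rewrite /quad !coefB coefC coefCM.
rewrite -(polyC_natr F 2) -polyCM !coefCM coefX coefXn.
by case: j j3 => [|[|[|]]] //= j _; rewrite !mulr0 !subr0.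
Qed.

Lemma horner_quad a r :
  (quad a).[r] = a 0 0 - 2%:R * a 0 2%:R * r - a 0 1 * r ^+ 2.
Proof. by rewrite /quad -(polyC_natr F 2) !(hornerE, horner_exp). Qed.

Lemma horner_dquad a r : (dquad a).[r] = - a 0 2%:R - a 0 1 * r.
Proof. by rewrite /dquad !hornerE. Qed.

Lemma size_quad_mul m a w :
  (size w <= m.-1)%N -> (size (quad a * w)%R <= m.+1)%N.
Proof.
have [->|w0 sw] := eqVneq w 0; first by rewrite mulr0 size_poly0.
have m1 : (1 < m)%N.
  by case: m sw => [|[|]] //=; rewrite leqn0 size_poly_eq0 (negPf w0).
apply: leq_trans (size_polyMleq _ _) _; rewrite -ltnS.
case: m m1 sw => [|[|m]] //= _ sw.
by have := leq_add (size_quad a) sw; case: (_ + _)%N.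
Qed.

(** The Lie derivative, along the vector field [quad a] d/dX, of a tensor density of weight -n/2. *)
Definition dens n a P : {poly F} := quad a * P^`() - n%:R * dquad a * P.

Lemma rVpoly_U_basis m k :
  (k <= m)%N -> rVpoly (U_basis F m k) = 'X^k.
Proof.
move=> km; rewrite -[in RHS](inordK (km : (k < m.+1)%N)) -rVpoly_delta.
by congr rVpoly; apply/rowP => i; rewrite !mxE eqxx /= -val_eqE /= inordK.
Qed.

Lemma horner_dens n a P r : (dens n a P).[r] =
  (quad a).[r] * P^`().[r] - n%:R * (dquad a).[r] * P.[r].
Proof. by rewrite /dens hornerD hornerN !hornerM -(polyC_natr F n) hornerC. Qed.

Fact dens_linear n a : linear (dens n a).
Proof.
move=> c P W; rewrite /dens derivD derivZ -!mul_polyC; ring.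
Qed.

HB.instance Definition _ n a :=
  GRing.isLinear.Build F _ _ *:%R (dens n a) (dens_linear n a).

(** The dictionary that turns later questions on modules into polynomial identities; both sides are
    linear, so the basis [u_k = X^k] suffices. *)
Lemma rVpoly_U m a (v : 'rV_m.+1) : rVpoly (U F m a v) = dens m a (rVpoly v).
Proof.
pose f : {linear 'rV[F]_m.+1 -> {poly F}} := rVpoly \o @U_act F m a.
pose g : {linear 'rV[F]_m.+1 -> {poly F}} := dens m a \o rVpoly.
apply: (eq_on_U_basis (f := f) (g := g)) v => k km; rewrite /f /g /= {f g}.
rewrite U_act_basis // /U_basis_act !linearD !linearZ /=.
(* For [k = m] the row is zero while the monomial is not, but the coefficient vanishes. *)
have -> : (m - k)%:R *: rVpoly (U_basis F m k.+1) = (m - k)%:R *: 'X^(k.+1).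
  case: (ltnP k m) => [lkm|]; first by rewrite rVpoly_U_basis.
  by rewrite -subn_eq0 => /eqP ->; rewrite !scale0r.
rewrite rVpoly_U_basis; last exact: leq_trans (leq_pred k) km.
rewrite rVpoly_U_basis //.
rewrite /dens /quad /dquad derivXn -!mul_polyC !natrB // !(polyCB, polyCM) !polyC_natr.
by case: k km => [|k] km /=; rewrite ?exprS; ring.
Qed.

Lemma size_rVpoly m (v : 'rV[F]_m) : (size (rVpoly v) <= m)%N.
Proof. exact: size_poly. Qed.

(** Each term alone may reach degree m+1. The cancellation there comes for free, since the result is
    again the polynomial of a row of length m+1. *)
Lemma size_dens m a P : (size P <= m.+1)%N -> (size (dens m a P) <= m.+1)%N.
Proof. by move=> /poly_rV_K <-; rewrite -rVpoly_U size_rVpoly. Qed.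

(** Leibniz rule: the weights of densities add under products and [quad a] has the weight of [U 2].
    Hence [w |-> (a |-> quad a * w)] is equivariant. *)
Lemma dens_quad_mul n a b w :
  dens n.+2 b (quad a * w) - quad [lie b, a] * w = quad a * dens n b w.
Proof.
by rewrite /dens quad_lie derivM deriv_quad -addn2 natrD; ring.
Qed.

(** The adjoint module is [U 2], so results on maps from sl_2 to [U m] also apply, with [m = 2], to
    endomorphisms of sl_2. *)
Lemma dens2 a b : dens 2 a (quad b) = quad [lie a, b].
Proof. by rewrite /dens quad_lie deriv_quad; ring. Qed.

(** The second transvectant of [quad a] and [W], an equivariant map
    [U_2 (x) U_(m+2) -> U_m]. *)
Definition transv m a W : {poly F} :=
  quad a * W^`()^`() - (m.+1.*2)%:R * dquad a * W^`()
  - (m.+1 * m.+2)%:R * (a 0 1)%:P * W.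

Lemma dens_transv m a b W :
  dens m b (transv m a W) - transv m [lie b, a] W = transv m a (dens m.+2 b W).
Proof.
(* This and the next identity are, up to constants, the first and second derivatives of [quad_lie].
   With them everything is expressed in [quad], [dquad], the [f]-coordinates and the derivatives of
   [W]. *)
have dquad_lie : dquad [lie b, a] = - quad b * (a 0 1)%:P + (b 0 1)%:P * quad a.
  by rewrite /quad /dquad /= !mxE /= !(polyCD, polyCB, polyCM, polyCN); ring.
have lie1 : ([lie b, a] 0 1)%:P =
    2%:R * (dquad b * (a 0 1)%:P - (b 0 1)%:P * dquad a).
  by rewrite /dquad /= !mxE /= !(polyCD, polyCB, polyCM, polyCN); ring.
rewrite /transv quad_lie dquad_lie lie1 /dens.
have EM k P : (k%:R * P)^`() = k%:R * P^`() by rewrite mulr_natl derivMn mulr_natl.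
rewrite -muln2 !natrM -!mulrA.
have DQ c P : (quad c * P)^`() = 2%:R * dquad c * P + quad c * P^`().
  by rewrite derivM deriv_quad.
have DS c P : (dquad c * P)^`() = - (c 0 1)%:P * P + dquad c * P^`().
  by rewrite derivM deriv_dquad.
have DC (c : F) P : (c%:P * P)^`() = c%:P * P^`().
  by rewrite derivM derivC mul0r add0r.
have D2 P : (2%:R * dquad b * P)^`() = 2%:R * (dquad b * P)^`().
  by rewrite -mulrA EM.
rewrite !(derivB, EM, DQ, DS, DC) derivD D2 !(DQ, DS) derivD -!polyCN DC DS !polyCN.
rewrite -!natr1; ring.
Qed.

(** In degree j the coefficients of [W] of degree j+1 and j enter with factors j - (m+1) and (j -
    (m+1)) (j - (m+2)). These vanish exactly where [W] could still contribute beyond degree m. *)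
Lemma size_transv m a W :
  (size W <= m.+3)%N -> (size (transv m a W) <= m.+1)%N.
Proof.
move=> /leq_sizeP sW; apply/leq_sizeP => j mj.
have E : (transv m a W)`_j =
  a 0 0 * (j.+1 * j.+2)%:R * W`_j.+2
  - 2%:R * a 0 2%:R * (j%:R - m.+1%:R) * j.+1%:R * W`_j.+1
  - a 0 1 * (j%:R - m.+1%:R) * (j%:R - m.+2%:R) * W`_j.
  have -> : transv m a W = a 0 0 *: W^`()^`()
      - (2%:R * a 0 2%:R) *: ('X * W^`()^`())
      - a 0 1 *: ('X^2 * W^`()^`()) + ((m.+1.*2)%:R * a 0 2%:R) *: W^`()
      + ((m.+1.*2)%:R * a 0 1) *: ('X * W^`()) - ((m.+1 * m.+2)%:R * a 0 1) *: W.
    by rewrite /transv /quad /dquad -!mul_polyC !polyCM !polyC_natr; ring.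
  have dE Q i : Q^`()`_i = i.+1%:R * Q`_i.+1 by rewrite coef_deriv mulr_natl.
  rewrite !(coefD, coefN, coefZ, coefXM, coefXnM, dE) -muln2 !natrM.
  by case: j {mj} => [|[|j]] /=; rewrite ?subSS ?subn0 -!natr1; ring.
rewrite E (sW j.+2) // mulr0.
move: mj; rewrite leq_eqVlt => /predU1P[<-|mj].
  by rewrite subrr !(mulr0, mul0r) !subr0.
rewrite (sW j.+1) // mulr0.
move: mj; rewrite leq_eqVlt => /predU1P[<-|mj].
  by rewrite (subrr m.+2%:R) !(mulr0, mul0r) !subr0.
by rewrite sW // mulr0 !subr0.
Qed.

End Density.

(** * The decomposition of Hom(sl_2, U_m) in polynomial form *)

Section HomSl2.
Variable F : numFieldType.
Implicit Types (a b : sl2 F) (P W w : {poly F}) (m n : nat).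
Implicit Types G : {linear sl2 F -> {poly F}}.

Lemma natf_neq0 n : n.+1%:R != 0 :> F.
Proof. by rewrite pnatr_eq0. Qed.

Lemma eq_on_sl2 (V : lmodType F) (f g : {linear sl2 F -> V}) :
  f (sl2_e F) = g (sl2_e F) -> f (sl2_f F) = g (sl2_f F) ->
  f (sl2_h F) = g (sl2_h F) -> f =1 g.
Proof.
by move=> Ee Ef Eh a; rewrite (sl2_decomp a) !linearD !linearZ /= Ee Ef Eh.
Qed.

(** A nonzero difference of size n would have the n naturals below n as distinct roots. *)
Lemma eq_horner P W : (forall r, P.[r] = W.[r]) -> P = W.
Proof.
move=> PW; apply/eqP; rewrite -subr_eq0; apply: contraT => nz.
have /= := max_poly_roots nz (rs := [seq i%:R | i <- iota 0 (size (P - W))]).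
rewrite size_map size_iota ltnn; apply.
  by apply/allP => _ /mapP[i _ ->]; rewrite /root hornerD hornerN PW subrr.
rewrite map_inj_uniq ?iota_uniq // => i j /eqP; rewrite eqr_nat; exact: eqP.
Qed.

Definition decomp m W P w a : {poly F} := transv m a W + dens m a P + quad a * w.

Fact decomp_linear m W P w : linear (decomp m W P w).
Proof.
move=> c a b; rewrite /decomp /transv /dens quad_linear dquad_linear !mxE.
by rewrite polyCD polyCM -!mul_polyC; ring.
Qed.

HB.instance Definition _ m W P w :=
  GRing.isLinear.Build F _ _ *:%R (decomp m W P w) (decomp_linear m W P w).

Lemma decomp_e m W P w : decomp m W P w (sl2_e F) = W^`()^`() + P^`() + w.
Proof.
by rewrite /decomp /transv /dens quad_e dquad_e !mxE /=; ring.
Qed.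

Lemma decomp_h m W P w : decomp m W P w (sl2_h F) =
  - (2%:R * 'X) * (W^`()^`() + P^`() + w) + (m.+1.*2)%:R * W^`() + m%:R * P.
Proof.
by rewrite /decomp /transv /dens quad_h dquad_h !mxE /=; ring.
Qed.

Lemma decomp_f m W P w : decomp m W P w (sl2_f F) =
  - 'X^2 * (W^`()^`() + P^`() + w) + (m.+1.*2)%:R * 'X * W^`()
  - (m.+1 * m.+2)%:R * W + m%:R * 'X * P.
Proof.
by rewrite /decomp /transv /dens quad_f dquad_f !mxE /=; ring.
Qed.

(** Writing D for the map, [X^2 D(e) + X D(h) - D(f)] is a nonzero multiple of [W]; once [W = 0],
    [D(h) + 2 X D(e)] is [m P], and then [D(e)] is [w]. *)
Lemma decomp_inj m W P w : (0 < m)%N ->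
  (forall a, decomp m W P w a = 0) -> [/\ W = 0, P = 0 & w = 0].
Proof.
move=> m0 D0.
have /eqP : (m.+1 * m.+2)%:R * W = 0.
  have -> : (m.+1 * m.+2)%:R * W = 'X^2 * decomp m W P w (sl2_e F)
     + 'X * decomp m W P w (sl2_h F) - decomp m W P w (sl2_f F).
    by rewrite decomp_e decomp_h decomp_f; ring.
  by rewrite !D0 !mulr0 subr0 addr0.
rewrite -polyC_natr mulf_eq0 polyC_eq0 pnatr_eq0 /= => /eqP W0.
have /eqP : m%:R * P = 0.
  have -> : m%:R * P =
      decomp m W P w (sl2_h F) + 2%:R * 'X * decomp m W P w (sl2_e F).
    by rewrite decomp_e decomp_h W0 !deriv0; ring.
  by rewrite !D0 !mulr0 addr0.
rewrite -polyC_natr mulf_eq0 polyC_eq0 pnatr_eq0 -leqn0 leqNgt m0 /= => /eqP P0.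
by split=> //; have := D0 (sl2_e F); rewrite decomp_e W0 P0 !deriv0 !add0r.
Qed.

Lemma size_decomp m W P w a :
  (size W <= m.+3)%N -> (size P <= m.+1)%N -> (size w <= m.-1)%N ->
  (size (decomp m W P w a) <= m.+1)%N.
Proof.
move=> sW sP sw; rewrite /decomp.
apply: leq_trans (size_polyD _ _) _; rewrite geq_max size_quad_mul // andbT.
by apply: leq_trans (size_polyD _ _) _; rewrite geq_max size_transv // size_dens.
Qed.

(** The values of [decomp m W P w] at [e], [h], [f] form a triangular system for
    [W], [P], [w]; the degree bounds come from a cancellation of the leading
    coefficients. *)
Lemma decomp_surj m G : (0 < m)%N -> (forall a, size (G a) <= m.+1)%N ->
  exists W P w, [/\ (size W <= m.+3)%N, (size P <= m.+1)%N, (size w <= m.-1)%N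
    & G =1 decomp m W P w].
Proof.
case: m => // n _ sG; set m := n.+1 in sG *.
pose E := G (sl2_e F); pose H := G (sl2_h F); pose K := G (sl2_f F).
have E0 j : (m < j)%N -> E`_j = 0 by move=> mj; apply/leq_sizeP: mj; exact: sG.
have H0 j : (m < j)%N -> H`_j = 0 by move=> mj; apply/leq_sizeP: mj; exact: sG.
have K0 j : (m < j)%N -> K`_j = 0 by move=> mj; apply/leq_sizeP: mj; exact: sG.
have dE (Q : {poly F}) i : Q^`()`_i = i.+1%:R * Q`_i.+1.
  by rewrite coef_deriv mulr_natl.
pose c : F := (m.+1%:R * m.+2%:R)^-1.
pose W : {poly F} := c *: ('X^2 * E + 'X * H - K).
have W2 j : W`_j.+2 = c * (E`_j + H`_j.+1 - K`_j.+2).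
  by rewrite coefZ coefB coefD coefXnM coefXM /= subSS subSS subn0.
have EW : (m.+1 * m.+2)%:R * W = 'X^2 * E + 'X * H - K.
  rewrite /W -polyC_natr mul_polyC scalerA natrM mulfV ?scale1r //.
  by rewrite mulf_neq0 ?natf_neq0.
clearbody W.
pose P : {poly F} :=
  (m%:R : F)^-1 *: (H + 2%:R *: ('X * E) - (2%:R * m.+1%:R) *: W^`()).
pose w := E - W^`()^`() - P^`().
have P1 j : P`_j.+1 =
    m%:R^-1 * (H`_j.+1 + 2%:R * E`_j - 2%:R * m.+1%:R * (j.+2%:R * W`_j.+2)).
  by rewrite coefZ coefB coefD !coefZ coefXM dE.
have sW : (size W <= m.+3)%N.
  apply/leq_sizeP => -[|[|j]] // mj; have {mj} mj : (m < j)%N by exact: mj.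
  rewrite W2 (E0 _ mj) (H0 _ (leqW mj)) (K0 _ (leqW (leqW mj))).
  by rewrite addr0 subr0 mulr0.
have sP : (size P <= m.+1)%N.
  apply/leq_sizeP => -[|j] //; rewrite ltnS => mj.
  rewrite P1 W2 (H0 _ (mj : (m < j.+1)%N)) (K0 _ (leqW (mj : (m < j.+1)%N))).
  move: mj; rewrite leq_eqVlt => /predU1P[<-|mj].
    by rewrite /c; field; rewrite -(natrD _ 2) nat1r !pnatr_eq0.
  by rewrite E0 // !(addr0, subr0, mulr0).
(* Degrees m-1 and m are the borderline ones: there coefficients of [E] and [H] within their bounds
   survive and cancel through the value of [c]. *)
have sw : (size w <= n)%N.
  apply/leq_sizeP => j nj; rewrite !coefB !dE.
  move: nj; rewrite leq_eqVlt => /predU1P[<-|nj].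
    rewrite P1 W2 (K0 n.+2) // /c /m; field.
    by rewrite -(natrD _ 3) -(natrD _ 2) nat1r !pnatr_eq0.
  have Pj : P`_j.+1 = 0 by apply: (leq_sizeP _ _ sP).
  rewrite Pj W2 (H0 _ (nj : (m < j.+1)%N)) (K0 _ (leqW (nj : (m < j.+1)%N))).
  rewrite mulr0 subr0.
  move: nj; rewrite leq_eqVlt => /predU1P[<-|mj].
    by rewrite /c /m; field; rewrite -(natrD _ 3) -(natrD _ 2) !pnatr_eq0.
  by rewrite E0 // !(addr0, subr0, mulr0).
exists W, P, w; split => //.
have EP : m%:R * P = H + 2%:R * ('X * E) - (m.+1.*2)%:R * W^`().
  rewrite /P -polyC_natr mul_polyC scalerA mulfV ?scale1r ?natf_neq0 //.
  by rewrite -!mul_polyC polyCM !polyC_natr -muln2 natrM; ring.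
apply: eq_on_sl2; rewrite -/E -/H -/K.
- by rewrite [RHS]decomp_e /w; ring.
- by rewrite [RHS]decomp_f EW -[_ * 'X * P]mulrAC EP /w; ring.
- by rewrite [RHS]decomp_h EP /w; ring.
Qed.

End HomSl2.

(** * Tests at nilpotent elements, cocycles, and scalar endomorphisms *)

Section Vanishing.
Variable F : numFieldType.
Implicit Types (a b : sl2 F) (P W w : {poly F}) (m n : nat).
Implicit Types G : {linear sl2 F -> {poly F}}.

(** The translates of [- f] under the flow of [e]; the coordinates are chosen so that the quadratic
    has the double root [r]. *)
Definition sl2_nilp (r : F) : sl2 F :=
  r ^+ 2 *: sl2_e F - sl2_f F + r *: sl2_h F.

Lemma quad_nilp r : quad (sl2_nilp r) = ('X - r%:P) ^+ 2.
Proof. by rewrite /quad !mxE /= !(polyCD, polyCM, polyCN); ring. Qed.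

Lemma dquad_nilp r : dquad (sl2_nilp r) = 'X - r%:P.
Proof. by rewrite /dquad !mxE /= !(polyCD, polyCM, polyCN); ring. Qed.

Lemma horner_dens_nilp m r P : (dens m (sl2_nilp r) P).[r] = 0.
Proof.
by rewrite /dens quad_nilp dquad_nilp !(hornerE, horner_exp) subrr; ring.
Qed.

(** The value at [r] of [G (sl2_nilp r)] is the value at [r] of [X^2 G(e) + X G(h) - G(f)], the very
    combination that isolates [(m+1)(m+2) W]. So the hypothesis makes [W] vanish at every point. *)
Lemma decomp_vanishing m G : (0 < m)%N -> (forall a, size (G a) <= m.+1)%N ->
  (forall r, (G (sl2_nilp r)).[r] = 0) ->
  exists P w : {poly F}, [/\ (size P <= m.+1)%N, (size w <= m.-1)%N
    & forall a, G a = dens m a P + quad a * w].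
Proof.
move=> m0 sG G0; have [W [P [w [sW sP sw EG]]]] := decomp_surj m0 sG.
exists P, w; split=> // a; rewrite EG /decomp.
suff -> : W = 0 by rewrite /transv !deriv0 !mulr0 !subr0 add0r.
have /eqP : (m.+1 * m.+2)%:R * W = 0.
  have -> : (m.+1 * m.+2)%:R * W =
      'X^2 * G (sl2_e F) + 'X * G (sl2_h F) - G (sl2_f F).
    by rewrite !EG decomp_e decomp_h decomp_f; ring.
  apply: eq_horner => r; rewrite !hornerE.
  by have := G0 r; rewrite linearD linearB !linearZ /= !hornerE => <-; ring.
by rewrite -polyC_natr mulf_eq0 polyC_eq0 pnatr_eq0 /= => /eqP.
Qed.

(** The first Whitehead lemma for sl_2 with coefficients in [U m], with an explicit primitive: the
    cocycle identity on the pairs (h,e), (h,f), (e,f) gives the differential equations below. *)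
Lemma cocycle_coboundary m G : (0 < m)%N -> (forall a, size (G a) <= m.+1)%N ->
  (forall a b, G [lie a, b] = dens m a (G b) - dens m b (G a)) ->
  exists2 P : {poly F}, (size P <= m.+1)%N & forall a, G a = dens m a P.
Proof.
move=> m0 sG cG.
pose E := G (sl2_e F); pose H := G (sl2_h F); pose K := G (sl2_f F).
have eH : H^`() = - (2%:R * 'X * E^`()) + (m%:R - 2%:R) * E.
  have := cG (sl2_h F) (sl2_e F); rewrite sl2_he linearZ /= -mul_polyC -/E -/H.
  rewrite polyC_natr /dens quad_h quad_e dquad_h dquad_e => /eqP.
  rewrite -subr_eq0 => /eqP E0; apply/eqP; rewrite -subr_eq0; apply/eqP.
  by rewrite -[RHS]E0; ring.
have eHK : - (2%:R * K) =
    - (2%:R * 'X * K^`()) + m%:R * K + 'X^2 * H^`() - m%:R * 'X * H.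
  have := cG (sl2_h F) (sl2_f F); rewrite sl2_hf linearN linearZ /=.
  by rewrite -mul_polyC -/K -/H polyC_natr /dens quad_h quad_f dquad_h dquad_f => ->; ring.
have eK : K^`() = H - 'X^2 * E^`() + m%:R * 'X * E.
  have := cG (sl2_e F) (sl2_f F); rewrite sl2_ef -/E -/K -/H.
  by rewrite /dens quad_e quad_f dquad_e dquad_f => ->; ring.
have K_E : K = 'X^2 * E + 'X * H.
  have /eqP : m.+2%:R * (K - 'X^2 * E - 'X * H) = 0.
    have -> : m.+2%:R * (K - 'X^2 * E - 'X * H) =
        m%:R * K - - (2%:R * K) - m.+2%:R * ('X^2 * E + 'X * H).
      by rewrite -!natr1; ring.
    by rewrite eHK eK eH -!natr1; ring.
  rewrite -polyC_natr mulf_eq0 polyC_eq0 pnatr_eq0 /= -addrA -opprD subr_eq0.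
  by move/eqP.
(* The only candidate: [P' = E] is required by [e], and [m P - 2 X P' = H] by [h]. *)
pose P : {poly F} := m%:R^-1 *: (H + 2%:R *: ('X * E)).
have EP : m%:R * P = H + 2%:R * ('X * E).
  rewrite /P -polyC_natr mul_polyC scalerA mulfV ?pnatr_eq0 -?lt0n // scale1r.
  by rewrite -!mul_polyC !polyC_natr.
have dP : P^`() = E.
  apply/eqP; rewrite -subr_eq0.
  have : m%:R * (P^`() - E) = 0.
    have -> : m%:R * (P^`() - E) = (m%:R * P)^`() - m%:R * E.
      by rewrite mulrBr [X in X - _]mulr_natl -derivMn -[P *+ m]mulr_natl.
    rewrite EP derivD eH [2%:R * ('X * E)]mulr_natl derivMn derivM derivX; ring.
  by move/eqP; rewrite -polyC_natr mulf_eq0 polyC_eq0 pnatr_eq0 eqn0Ngt m0.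
exists P.
  apply/leq_sizeP => -[|j] //; rewrite ltnS => mj.
  rewrite coefZ coefD coefZ coefXM /=.
  rewrite [H`_j.+1](leq_sizeP _ _ (sG _)) // add0r.
  move: mj; rewrite leq_eqVlt => /predU1P[<-|mj]; last first.
    by rewrite [E`_j](leq_sizeP _ _ (sG _)) // !mulr0.
  (* The degree bound on [P] needs the top coefficient of [E] to vanish. In degree m, [eH] has zero
     on the left and -(m+2) times this coefficient on the right. *)
  have : (m.+2)%:R * E`_m = 0.
    have := congr1 (fun p : {poly F} => p`_m) eH.
    rewrite coef_deriv [H`_m.+1](leq_sizeP _ _ (sG _)) // mul0rn.
    have -> : - (2%:R * 'X * E^`()) + (m%:R - 2%:R) * E =
       - (2%:R *: ('X * E^`())) + (m%:R - 2%:R) *: E.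
      by rewrite -!mul_polyC polyCB !polyC_natr mulrA.
    rewrite coefD coefN !coefZ coefXM; case: (m) m0 => // n _ /=.
    rewrite coef_deriv -mulr_natl => e; rewrite -[RHS]oppr0 [X in - X]e.
    by rewrite -!natr1; ring.
  by move/eqP; rewrite mulf_eq0 pnatr_eq0 /= => /eqP ->; rewrite !mulr0.
pose D : {linear _ -> _} := decomp m 0 P 0.
have DE a : dens m a P = D a.
  by rewrite /D /= /decomp /transv !deriv0 !mulr0 !subr0 add0r addr0.
move=> a; rewrite DE; apply: eq_on_sl2 a; rewrite /D -/E -/H -/K.
- by rewrite [RHS]decomp_e dP !deriv0 add0r addr0.
- by rewrite [RHS]decomp_f dP deriv0 -[_ * 'X * P]mulrAC EP K_E deriv0; ring.
- by rewrite [RHS]decomp_h dP EP !deriv0; ring.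
Qed.

(** [d v] and [v * d 1] agree at every point, and the degree of [d X^m] forces [d 1]
    to be constant. *)
Lemma vanishing_scalar m (d : 'End('rV[F]_m.+1)) :
  (forall r (v : 'rV_m.+1), (rVpoly v).[r] = 0 -> (rVpoly (d v)).[r] = 0) ->
  exists c, forall v, d v = c *: v.
Proof.
move=> d0; pose L := rVpoly (d (U_basis F m 0)).
have dL v : rVpoly (d v) = rVpoly v * L.
  apply: eq_horner => r; rewrite hornerM.
  have := d0 r (v - (rVpoly v).[r] *: U_basis F m 0).
  rewrite !linearB !linearZ /= rVpoly_U_basis // expr0 !hornerE !mulrN mulr1 subrr.
  by move=> /(_ erefl) /eqP; rewrite subr_eq0 => /eqP.
have sL : (size L <= 1)%N.
  have := size_rVpoly (d (U_basis F m m)); rewrite dL rVpoly_U_basis //.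
  have [->|L0] := eqVneq L 0; first by rewrite size_poly0.
  by rewrite mulrC size_mulXn // -(addn1 m) leq_add2l.
exists L`_0 => v; apply: (can_inj rVpolyK); rewrite linearZ /= dL.
by rewrite (size1_polyC sL) coefC /= mulrC mul_polyC.
Qed.

End Vanishing.

(** * The image of the operator attached to a quadratic *)

Section Image.
Variable F : fieldType.
Implicit Types P Q R g q : {poly F}.

(** The indicial equation at the singular point [r]: [k] is the order of vanishing of [P] there, and
    the lowest order terms at [r] are compared. *)
Lemma deriv_multiplicity P g q r : P != 0 ->
  ('X - r%:P) * q * P^`() = g * P ->
  exists2 k, (k < size P)%N & k%:R * q.[r] = g.[r].
Proof.
move=> P0; have [k [R]] := multiplicity_XsubC P r; rewrite P0 /= => Rr defP.
have R0 : R != 0 by apply: contraNneq Rr => ->; rewrite root0.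
move=> eP; exists k.
  rewrite defP size_Mmonic ?monic_exp ?monicXsubC // size_exp_XsubC addnS /=.
  by rewrite -[k.+1]add1n leq_add2r lt0n size_poly_eq0.
have : q * (R^`() * ('X - r%:P) + k%:R * R) = g * R.
  have nz : ('X - r%:P) ^+ k != 0 by rewrite expf_neq0 // polyXsubC_eq0.
  apply: (mulIf nz); rewrite -[RHS]mulrA -defP -eP defP derivM deriv_exp.
  rewrite derivXsubC mul1r -mulr_natl; case: (k) => [|j].
    by rewrite mulr0n; ring.
  by rewrite exprS; ring.
move/(congr1 (horner^~ r)); rewrite /= !hornerE subrr mulr0 add0r.
rewrite -polyC_natr hornerC mulrA => e.
by apply: (mulIf Rr); rewrite -e; ring.
Qed.

(** An injective endomorphism of the finite-dimensional space of polynomials of size at most [n] is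
    onto; rows carry the dimension argument. *)
Lemma inj_surj_poly n (f : {linear {poly F} -> {poly F}}) :
  (forall P, (size P <= n)%N -> (size (f P) <= n)%N) ->
  (forall P, (size P <= n)%N -> f P = 0 -> P = 0) ->
  forall Q, (size Q <= n)%N -> exists2 P : {poly F}, (size P <= n)%N & f P = Q.
Proof.
move=> sf f0 Q sQ.
pose h : {linear 'rV[F]_n -> 'rV[F]_n} := poly_rV \o f \o rVpoly.
have hE v : rVpoly (linfun h v) = f (rVpoly v).
  by rewrite lfunE /= poly_rV_K // sf // size_rVpoly.
have ker0 : lker (linfun h) == 0%VS.
  apply/lker0P/raddf_inj => v hv; apply: (can_inj rVpolyK).
  by rewrite linear0; apply: f0; rewrite ?size_rVpoly // -hE hv linear0.
exists (rVpoly ((linfun h)^-1%VF (poly_rV Q))); first exact: size_rVpoly.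
by rewrite -hE lker0_lfunVK // poly_rV_K.
Qed.

(** What [dens n] at [sl2_nilp r] becomes after division by [X - r]. *)
Definition euler n r P := ('X - r%:P) * P^`() - n%:R * P.

Fact euler_linear n r : linear (euler n r).
Proof. by move=> c P Q; rewrite /euler derivD derivZ -!mul_polyC; ring. Qed.

HB.instance Definition _ n r :=
  GRing.isLinear.Build F _ _ *:%R (euler n r) (euler_linear n r).

End Image.

Lemma size_XsubC_mul (F : fieldType) m (r : F) (P : {poly F}) : (0 < m)%N ->
  (size P <= m.-1)%N -> (size (('X - r%:P) * P)%R <= m)%N.
Proof.
move=> m0 sP; apply: leq_trans (size_polyMleq _ _) _.
by rewrite size_XsubC /= -(prednK m0) ltnS.
Qed.

(** A nonzero kernel element would vanish to order exactly m at [r], which is excluded in degree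
    less than m. *)
Lemma euler_surj (F : numFieldType) m (r : F) (Q : {poly F}) : (size Q <= m)%N ->
  exists2 P : {poly F}, (size P <= m)%N & euler m r P = Q.
Proof.
case: m => [|m] sQ.
  exists 0; first by rewrite size_poly0.
  by rewrite linear0; move: sQ; rewrite leqn0 size_poly_eq0 => /eqP.
apply: inj_surj_poly sQ => P sP.
- apply: leq_trans (size_polyD _ _) _; rewrite geq_max size_polyN.
  have -> : (size (m.+1%:R * P)%R <= m.+1)%N.
    by rewrite -polyC_natr mul_polyC (leq_trans (size_scale_leq _ _)).
  rewrite andbT size_XsubC_mul //; apply/leq_sizeP => j mj.
  by rewrite coef_deriv (leq_sizeP _ _ sP) ?mul0rn.
- move=> /eqP; rewrite subr_eq0 => /eqP eP; apply/eqP/contraT => P0.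
  have [|k kP] := deriv_multiplicity (r := r) (q := 1) (g := m.+1%:R) P0.
    by rewrite mulr1.
  rewrite -polyC_natr !hornerC mulr1 => /eqP; rewrite eqr_nat => /eqP km.
  by move: (leq_trans kP sP); rewrite km ltnn.
Qed.

Lemma quad_mul_in_dens (F : numClosedFieldType) m (a : sl2 F) (w : {poly F}) :
  odd m -> (size w <= m.-1)%N ->
  exists2 P : {poly F}, (size P <= m.+1)%N & dens m a P = quad a * w.
Proof.
move=> om sw; have m0 : (0 < m)%N by case: m om {sw}.
have simple_root r : (quad a).[r] = 0 -> (dquad a).[r] != 0 ->
    exists2 P : {poly F}, (size P <= m.+1)%N & dens m a P = quad a * w.
  move=> qr sr; apply: inj_surj_poly.
  - exact: size_dens.
  - move=> P _ /eqP; rewrite subr_eq0 => /eqP eP; apply/eqP/contraT => P0.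
    have /factor_theorem[q defq] : root (quad a) r by apply/eqP.
    have q2 : q.[r] = 2%:R * (dquad a).[r].
      have := congr1 (fun p : {poly F} => p^`().[r]) defq.
      rewrite deriv_quad derivM derivXsubC !hornerE subrr mulr0 add0r => <-; ring.
    have [|k _] := deriv_multiplicity (r := r) (q := q) (g := m%:R * dquad a) P0.
      by rewrite [_ * q]mulrC -defq; exact: eP.
    (* At a simple root the indicial equation reads 2k = m, against the parity of m. *)
    rewrite q2 hornerM -polyC_natr hornerC mulrA => /(mulIf sr) /eqP.
    by rewrite -natrM eqr_nat => /eqP km; move: om; rewrite -km oddM andbF.
  - exact: size_quad_mul.
have [a1|a1] := eqVneq (a 0 1) 0.
  have [a2|a2] := eqVneq (a 0 2%:R) 0.
    have qE : quad a = (a 0 0)%:P by rewrite /quad a1 a2; ring.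
    (* For constant [quad a] the equation only asks for a primitive of [w]; the term [i = 0] is a
       division by zero, hence 0. *)
    exists (\poly_(i < m) (w`_i.-1 / i%:R)).
      by rewrite leqW // size_poly.
    have -> : dens m a (\poly_(i < m) (w`_i.-1 / i%:R)) =
        quad a * (\poly_(i < m) (w`_i.-1 / i%:R))^`().
      by rewrite /dens /dquad a1 a2; ring.
    congr (_ * _); apply/polyP => i; rewrite coef_deriv coef_poly.
    case: (ltnP i.+1 m) => im; first by rewrite /= -[LHS]mulr_natr divfK ?pnatr_eq0.
    by rewrite mul0rn (leq_sizeP _ _ sw) // -ltnS prednK.
  apply: (simple_root (a 0 0 / (2%:R * a 0 2%:R))).
    by rewrite horner_quad a1; field.
  by rewrite horner_dquad a1 mul0r subr0 oppr_eq0.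
(* A square root of the quarter discriminant. At the root [r] below, [dquad a] takes the value
   [- d], so [r] is simple exactly when [d] is nonzero. *)
pose d := sqrtC (a 0 2%:R ^+ 2 + a 0 0 * a 0 1).
have dK : d ^+ 2 = a 0 2%:R ^+ 2 + a 0 0 * a 0 1 by rewrite sqrtCK.
pose r := (d - a 0 2%:R) / a 0 1.
have ar : a 0 1 * r = d - a 0 2%:R by rewrite /r mulrC divfK.
have a0 : a 0 0 = r * (d + a 0 2%:R).
  apply: (mulfI a1); rewrite mulrA ar mulrC -[LHS](addrK (a 0 2%:R ^+ 2)).
  by rewrite [_ + _ ^+ 2]addrC -dK; ring.
have qr : (quad a).[r] = 0.
  by rewrite horner_quad a0; ring: ar.
have [d0|d0] := eqVneq d 0; last first.
  apply: (simple_root r) => //.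
  have -> : (dquad a).[r] = - d by rewrite horner_dquad ar; ring.
  by rewrite oppr_eq0.
have a2 : a 0 2%:R = - (a 0 1 * r) by rewrite ar d0; ring.
have sE : dquad a = - (a 0 1)%:P * ('X - r%:P).
  by rewrite /dquad a2 polyCN polyCM; ring.
have qE : quad a = - (a 0 1)%:P * ('X - r%:P) ^+ 2.
  by rewrite /quad a0 d0 add0r a2 !(polyCN, polyCM); ring.
(* With a double root, dividing by [- a_f (X - r)] turns the equation into
   [euler m r P = (X - r) w]. *)
have [P sP eP] := euler_surj r (size_XsubC_mul r m0 sw).
exists P; first exact: leqW.
have -> : dens m a P = - (a 0 1)%:P * ('X - r%:P) * euler m r P.
  by rewrite /dens sE qE /euler; ring.
by rewrite eP qE; ring.
Qed.

Definition linear_of (F : fieldType) (U V : lmodType F) (f : U -> V)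
    (lf : linear f) : {linear U -> V} :=
  HB.pack f (GRing.isLinear.Build F U V *:%R f lf).

Lemma lieNl (F : fieldType) (L : lieType F) (x y : L) : [lie - x, y] = [lie y, x].
Proof. by rewrite lie_anti linearN opprK. Qed.

Lemma actNr (F : fieldType) (L : lieType F) (V : vectType F)
  (rho : lieModule L V) x v : rho x (- v) = - rho x v.
Proof. exact: linearN. Qed.

Lemma act0r (F : fieldType) (L : lieType F) (V : vectType F)
  (rho : lieModule L V) x : rho x 0 = 0.
Proof. exact: linear0. Qed.

#[local] Arguments U : simpl never.

(** * The map from the model Lie algebra to endomorphisms *)

Section GalileiMap.
Variables (F : numFieldType) (m : nat).
Hypothesis m_gt1 : (1 < m)%N.
Implicit Types (a b : sl2 F) (v P : 'rV[F]_m.+1) (w : 'rV[F]_(m - 2).+1).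

(** The values at 0, 1 and -1 recover the coordinates, as 2 is invertible. With [quad_surj] this
    identifies sl_2 with the polynomials of degree at most 2. *)
Lemma quad_inj : injective (@quad F).
Proof.
move=> a b e; have q r : (quad a).[r] = (quad b).[r] by rewrite e.
have e0 : a 0 0 = b 0 0.
  by have := q 0; rewrite !horner_quad expr0n !mulr0 !subr0.
have := q 1; have := q (-1); rewrite !horner_quad e0 => qm q1.
have e1 : a 0 1 = b 0 1.
  have -> : a 0 1 = (2%:R * b 0 0 -
     (b 0 0 - 2%:R * a 0 2%:R * -1 - a 0 1 * (-1) ^+ 2)
     - (b 0 0 - 2%:R * a 0 2%:R * 1 - a 0 1 * 1 ^+ 2)) / 2%:R by field.
  by rewrite qm q1; field.
have e2 : a 0 2%:R = b 0 2%:R.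
  have -> : a 0 2%:R =
     ((b 0 0 - 2%:R * a 0 2%:R * -1 - a 0 1 * (-1) ^+ 2)
     - (b 0 0 - 2%:R * a 0 2%:R * 1 - a 0 1 * 1 ^+ 2)) / 4%:R by field.
  by rewrite qm q1; field.
by rewrite (sl2_decomp a) (sl2_decomp b) e0 e1 e2.
Qed.

Lemma quad_surj (P : {poly F}) : (size P <= 3)%N -> exists a, P = quad a.
Proof.
move=> sP; have [c e1] : exists c, P`_1 = 2%:R * c.
  by exists (P`_1 / 2%:R); field.
exists (P`_0 *: sl2_e F - P`_2 *: sl2_f F - c *: sl2_h F).
rewrite -[LHS]coefK; have -> : \poly_(i < size P) P`_i = \poly_(i < 3) P`_i.
  apply/polyP => i; rewrite !coef_poly; case: (ltnP i (size P)) => iP.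
    by rewrite (leq_trans iP sP).
  by rewrite nth_default //; case: ifP.
rewrite poly_def !big_ord_recl big_ord0 /= /bump /= -!mul_polyC /quad !mxE /=.
by rewrite e1 !(polyCD, polyCN, polyCM); ring.
Qed.

Definition star a w : 'rV[F]_m.+1 := poly_rV (quad a * rVpoly w).

Lemma pred_subn2 : m.-1 = (m - 2).+1.
Proof. by case: (m) m_gt1 => [|[|k]] //= _; rewrite subSS subSS subn0. Qed.

Lemma size_rVpoly_low w : (size (rVpoly w) <= m.-1)%N.
Proof. by rewrite pred_subn2 size_rVpoly. Qed.

Lemma rVpoly_star a w : rVpoly (star a w) = quad a * rVpoly w.
Proof. by rewrite poly_rV_K // size_quad_mul // size_rVpoly_low. Qed.

Lemma rVpolyD n (x y : 'rV[F]_n) : rVpoly (x + y) = rVpoly x + rVpoly y.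
Proof. exact: linearD. Qed.

Lemma rVpolyB n (x y : 'rV[F]_n) : rVpoly (x - y) = rVpoly x - rVpoly y.
Proof. exact: linearB. Qed.

Lemma rVpolyZ n (c : F) (x : 'rV[F]_n) : rVpoly (c *: x) = c%:P * rVpoly x.
Proof. by rewrite linearZ /= -mul_polyC. Qed.

Lemma star_linearl w : linear (star^~ w).
Proof.
move=> c a b; rewrite /star -linearP; congr poly_rV.
by rewrite quad_linear -!mul_polyC; ring.
Qed.

Lemma star_linearr a : linear (star a).
Proof.
move=> c w w'; rewrite /star -linearP; congr poly_rV.
by rewrite rVpolyD rVpolyZ -mul_polyC; ring.
Qed.

HB.instance Definition _ a :=
  GRing.isLinear.Build F _ _ *:%R (star a) (star_linearr a).

Lemma starD a w w' : star a (w + w') = star a w + star a w'.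
Proof. exact: linearD. Qed.

Lemma starB a w w' : star a (w - w') = star a w - star a w'.
Proof. exact: linearB. Qed.

Lemma starZ a c w : star a (c *: w) = c *: star a w.
Proof. exact: linearZ. Qed.

Lemma star_act a b w :
  star a (U F (m - 2) b w) = U F m b (star a w) - star [lie b, a] w.
Proof.
apply: (can_inj rVpolyK); rewrite rVpolyB rVpoly_U !rVpoly_star rVpoly_U.
by rewrite -dens_quad_mul -[X in dens X]addn2 subnK.
Qed.

(** [((b, c), (P, w))] is sent to [ad b + c d0 + ad P + (a |-> quad a * w)]. *)
Definition locder_fun (x : locder_model F m) (p : galilei F m) : galilei F m :=
  ([lie x.1.1, p.1],
   U F m x.1.1 p.2 - U F m p.1 x.2.1 + x.1.2 *: p.2 + star p.1 x.2.2).

Fact locder_fun_linearr x : linear (locder_fun x).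
Proof.
move=> c p q; congr pair; first exact: lie_linearr.
rewrite -[(c *: p + q).1]/(c *: p.1 + q.1) -[(c *: p + q).2]/(c *: p.2 + q.2).
rewrite -[(c *: locder_fun x p).2]/(c *: (locder_fun x p).2) /locder_fun.
rewrite star_linearl act_linearl act_linearr [in RHS]/=.
by apply/rowP => i; rewrite !mxE; ring.
Qed.

Definition locder_map x : 'End(galilei F m) :=
  linfun (linear_of (locder_fun_linearr x)).

Lemma locder_mapE x p : locder_map x p = locder_fun x p.
Proof. exact: lfunE. Qed.

Fact locder_map_linear : linear (locder_map : locder_model F m -> gl (galilei F m)).
Proof.
move=> c x y; apply/lfunP => p.
rewrite add_lfunE scale_lfunE !locder_mapE; congr pair; first exact: lie_linearl.
case: x y p => -[b d] [P w] [[b' d'] [P' w']] [a v].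
rewrite -[X in X = _]/(U F m (c *: b + b') v - U F m a (c *: P + P')
  + (c * d + d') *: v + star a (c *: w + w')).
rewrite -[X in _ = X]/(c *: (U F m b v - U F m a P + d *: v + star a w) +
  (U F m b' v - U F m a P' + d' *: v + star a w')).
rewrite star_linearr act_linearl act_linearr.
by apply/rowP => i; rewrite !mxE; ring.
Qed.

(** The sl_2 component is the Jacobi identity; the other one combines the module law of [U m] with
    the equivariance [star_act]. Once the image is known, this carries the structure of the model
    over to local derivations. *)
Lemma locder_map_lie (x y : locder_model F m) :
  locder_map [lie x, y] = [lie locder_map x : gl (galilei F m), locder_map y].
Proof.
apply/lfunP => p; rewrite [RHS]commutatorE !locder_mapE.
case: x y p => -[b c] [P w] [[b' c'] [P' w']] [a v].
congr pair.
  rewrite -[LHS]/([lie [lie b, b'], a]).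
  rewrite -[RHS]/([lie b, [lie b', a]] - [lie b', [lie b, a]]).
  have /eqP := lie_jacobi b b' a; rewrite addr_eq0 => /eqP E.
  by rewrite [LHS]lie_anti -E [ [lie a, b] ]lie_anti linearN.
rewrite -[LHS]/(U F m [lie b, b'] v
  - U F m a (U F m b P' + c *: P' - (U F m b' P + c' *: P))
  + 0 *: v + star a (U F (m - 2) b w' + c *: w' - (U F (m - 2) b' w + c' *: w))).
rewrite -[RHS]/(U F m b (U F m b' v - U F m a P' + c' *: v + star a w')
  - U F m [lie b', a] P
  + c *: (U F m b' v - U F m a P' + c' *: v + star a w') + star [lie b', a] w
  - (U F m b' (U F m b v - U F m a P + c *: v + star a w)
  - U F m [lie b, a] P'
  + c' *: (U F m b v - U F m a P + c *: v + star a w) + star [lie b, a] w')).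
rewrite starB !starD !starZ !star_act !act_lie.
rewrite !(actDr, actNr, actZr) scale0r.
by apply/rowP => i; rewrite !mxE; ring.
Qed.

End GalileiMap.

(** * Blocks of an endomorphism, and derivations from the model *)

Section GalileiDer.
Variables (F : numFieldType) (m : nat).
Implicit Types (a b : sl2 F) (v P : 'rV[F]_m.+1) (w : 'rV[F]_(m - 2).+1).
Implicit Types D : 'End(galilei F m).

Lemma galilei_lie (p q : galilei F m) :
  [lie p, q] = ([lie p.1, q.1], U F m p.1 q.2 - U F m q.1 p.2) :> galilei F m.
Proof. by []. Qed.

Definition galilei_U v : galilei F m := (0, v).

Lemma galilei_split (p : galilei F m) : p = galilei_sl2 m p.1 + galilei_U p.2.
Proof. by case: p => a v; congr pair; rewrite /= ?addr0 ?add0r. Qed.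

Lemma galilei_apply D (p : galilei F m) :
  D p = ((D (galilei_sl2 m p.1)).1 + (D (galilei_U p.2)).1,
         (D (galilei_sl2 m p.1)).2 + (D (galilei_U p.2)).2).
Proof. by rewrite {1}(galilei_split p) linearD. Qed.

Fact galilei_sl2_linear : linear (@galilei_sl2 F m).
Proof. by move=> c a b; congr pair; rewrite /= scaler0 addr0. Qed.

Fact galilei_U_linear : linear galilei_U.
Proof. by move=> c v w; congr pair; rewrite /= scaler0 addr0. Qed.

HB.instance Definition _ :=
  GRing.isLinear.Build F _ _ *:%R (@galilei_sl2 F m) galilei_sl2_linear.
HB.instance Definition _ :=
  GRing.isLinear.Build F _ _ *:%R galilei_U galilei_U_linear.

(** Composing with [quad] makes this block a map into the polynomials of [U 2], on the same footing
    as [part21] into those of [U m]. *)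
Definition part11 D : {linear sl2 F -> {poly F}} :=
  @quad F \o fst \o D \o @galilei_sl2 F m.
Definition part21 D : {linear sl2 F -> {poly F}} :=
  rVpoly \o snd \o D \o @galilei_sl2 F m.
Definition part12 D : {linear 'rV[F]_m.+1 -> sl2 F} :=
  fst \o D \o galilei_U.
Definition part22 D : {linear 'rV[F]_m.+1 -> 'rV[F]_m.+1} :=
  snd \o D \o galilei_U.

(** Such a map is the inner derivation by [(b, P)] plus [c] times the projection onto the abelian
    ideal. *)
Lemma locder_map_Der x : x.2.2 = 0 -> Der (galilei F m) (locder_map x).
Proof.
case: x => -[b c] [P w] /= -> p q; rewrite !locder_mapE.
case: p q => [a v] [a' v']; congr pair.
  rewrite -[LHS]/([lie b, [lie a, a']]).
  rewrite -[RHS]/([lie [lie b, a], a'] + [lie a, [lie b, a']]).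
  have /eqP := lie_jacobi b a a'; rewrite -addrA addr_eq0 => /eqP ->.
  rewrite [ [lie a', b] ]lie_anti linearN.
  by rewrite [ [lie a', [lie b, a]] ]lie_anti opprD !opprK addrC.
rewrite -[LHS]/(U F m b (U F m a v' - U F m a' v) - U F m [lie a, a'] P
  + c *: (U F m a v' - U F m a' v) + star [lie a, a'] 0).
rewrite -[RHS]/(U F m [lie b, a] v'
   - U F m a' (U F m b v - U F m a P + c *: v + star a 0)
   + (U F m a (U F m b v' - U F m a' P + c *: v' + star a' 0)
   - U F m [lie b, a'] v)).
rewrite !linear0 !addr0 !act_lie !(actDr, actNr, actZr).
by apply/rowP => i; rewrite !mxE; ring.
Qed.
End GalileiDer.

(** * Classification of the derivations *)

Section DerClassification.
Variables (F : numFieldType) (m : nat).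
Hypotheses (m_gt1 : (1 < m)%N) (m_odd : odd m).
Implicit Types (a b : sl2 F) (v P : 'rV[F]_m.+1) (w : 'rV[F]_(m - 2).+1).
Implicit Types D : 'End(galilei F m).

Lemma locder_map_intro D b c P w :
  (forall v, (D (galilei_U v)).1 = 0) ->
  (forall a, (D (galilei_sl2 m a)).1 = [lie b, a]) ->
  (forall a, (D (galilei_sl2 m a)).2 = star a w - U F m a P) ->
  (forall v, (D (galilei_U v)).2 = U F m b v + c *: v) ->
  D = locder_map ((b, c), (P, w)).
Proof.
move=> D12 D11 D21 D22; apply/lfunP => p.
rewrite galilei_apply locder_mapE D12 D11 D21 D22 addr0; congr pair => /=.
by apply/rowP => i; rewrite !mxE; ring.
Qed.

Lemma galilei_scalar D b :
  (forall r v, (rVpoly v).[r] = 0 ->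
     (rVpoly ((D (galilei_U v)).2 - U F m b v)).[r] = 0) ->
  exists c, forall v, (D (galilei_U v)).2 = U F m b v + c *: v.
Proof.
move=> dr; pose d := linfun (part22 D \- U F m b).
have dE v : d v = (D (galilei_U v)).2 - U F m b v by rewrite lfunE.
have [|c cP] := vanishing_scalar (d := d).
  by move=> r v; rewrite dE; apply: dr.
by exists c => v; rewrite -cP dE addrC subrK.
Qed.

Lemma odd_natrB_neq0 n k : odd n -> n%:R - 2%:R * k%:R != 0 :> F.
Proof.
by rewrite subr_eq0 -natrM eqr_nat; apply: contraTneq => ->; rewrite oddM.
Qed.

Lemma Der_sl2_U D a v : Der (galilei F m) D -> D (galilei_U (U F m a v)) =
  ([lie a, (D (galilei_U v)).1],
   U F m (D (galilei_sl2 m a)).1 v + U F m a (D (galilei_U v)).2).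
Proof.
move=> DD.
have -> : galilei_U (U F m a v) = [lie galilei_sl2 m a, galilei_U v].
  rewrite galilei_lie; congr pair; first by rewrite [RHS]lie0r.
  by rewrite -[RHS]/(U F m a v - U F m 0 0) act0l subr0.
rewrite DD !galilei_lie; congr pair.
  rewrite -[LHS]/([lie (D (galilei_sl2 m a)).1, 0]
    + [lie a, (D (galilei_U v)).1]).
  by rewrite lie0r add0r.
rewrite -[LHS]/(U F m (D (galilei_sl2 m a)).1 v - U F m 0 (D (galilei_sl2 m a)).2
  + (U F m a (D (galilei_U v)).2 - U F m (D (galilei_U v)).1 0)).
by rewrite act0l act0r !subr0.
Qed.

Lemma Der_sl2_sl2 D a b : Der (galilei F m) D -> D (galilei_sl2 m [lie a, b]) =
  ([lie (D (galilei_sl2 m a)).1, b] + [lie a, (D (galilei_sl2 m b)).1],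
   U F m a (D (galilei_sl2 m b)).2 - U F m b (D (galilei_sl2 m a)).2).
Proof.
move=> DD.
have -> : galilei_sl2 m [lie a, b] = [lie galilei_sl2 m a, galilei_sl2 m b].
  rewrite galilei_lie; congr pair.
  by rewrite -[RHS]/(U F m a 0 - U F m b 0) !act0r subr0.
rewrite DD !galilei_lie; congr pair.
rewrite -[LHS]/(U F m (D (galilei_sl2 m a)).1 0 - U F m b (D (galilei_sl2 m a)).2
  + (U F m a (D (galilei_sl2 m b)).2 - U F m (D (galilei_sl2 m b)).1 0)).
by rewrite !act0r subr0 add0r addrC.
Qed.

(** The sl_2 component of the image of [u_k] is an eigenvector of ad h for the odd number m - 2k, or
    zero; but the eigenvalues of ad h on sl_2 are 2, -2 and 0. *)
Lemma Der_galilei_U D v : Der (galilei F m) D -> (D (galilei_U v)).1 = 0.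
Proof.
move=> DD; pose f : {linear 'rV[F]_m.+1 -> sl2 F} := part12 D.
pose g : {linear 'rV[F]_m.+1 -> sl2 F} := \0.
apply: (eq_on_U_basis (f := f) (g := g)) v => k km; rewrite /f /g /= {f g}.
set y := (_ _).1.
have : (m%:R - 2%:R * k%:R) *: y = [lie sl2_h F, y].
  have /(congr1 fst) := Der_sl2_U (sl2_h F) (U_basis F m k) DD.
  by rewrite U_h // linearZ /= linearZ.
move=> e; have e0 := congr1 (fun x : sl2 F => x 0 0) e.
have e1 := congr1 (fun x : sl2 F => x 0 1) e.
have e2 := congr1 (fun x : sl2 F => x 0 2%:R) e.
move: e0 e1 e2; rewrite /= !mxE /= => e0 e1 e2.
have z0 : y 0 0 = 0.
  apply: (mulfI (odd_natrB_neq0 k.+1 m_odd)); rewrite mulr0 -natr1.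
  transitivity ((m%:R - 2%:R * k%:R) * y 0 0 - 2%:R * y 0 0); first by ring.
  by rewrite e0; ring.
have z1 : y 0 1 = 0.
  have m2_odd : odd m.+2 by rewrite /= negbK.
  apply: (mulfI (odd_natrB_neq0 k m2_odd)); rewrite mulr0 -!natr1.
  transitivity ((m%:R - 2%:R * k%:R) * y 0 1 + 2%:R * y 0 1); first by ring.
  by rewrite e1; ring.
have z2 : y 0 2%:R = 0.
  apply: (mulfI (odd_natrB_neq0 k m_odd)); rewrite mulr0 e2; ring.
by rewrite (sl2_decomp y) z0 z1 z2 !scale0r !addr0.
Qed.

Lemma Der_locder_map D : Der (galilei F m) D ->
  exists2 x : locder_model F m, x.2.2 = 0 & D = locder_map x.
Proof.
move=> DD; have m0 := ltnW m_gt1.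
pose i1 := @galilei_sl2 F m; pose i2 := @galilei_U F m.
have Dlie a b : ((D (i1 [lie a, b])).1 =
      [lie (D (i1 a)).1, b] + [lie a, (D (i1 b)).1]) *
    ((D (i1 [lie a, b])).2 = U F m a (D (i1 b)).2 - U F m b (D (i1 a)).2).
  by rewrite /i1 Der_sl2_sl2.
(* Both blocks on sl_2 are cocycles, with values in [U 2] and in [U m]. The signs in [- b'] and
   [- poly_rV Q] turn the coboundaries into inner derivations. *)
have [||P sP DP] := @cocycle_coboundary F 2 (part11 D) isT.
- by move=> a; apply: size_quad.
- move=> a b; by rewrite /= Dlie !dens2 lie_anti addrC linearB.
have [b' defP] := quad_surj sP.
have D11 a : (D (i1 a)).1 = [lie - b', a].
  apply: quad_inj; rewrite [LHS]DP defP dens2; congr quad.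
  by rewrite lieNl.
have [||Q sQ DQ] := @cocycle_coboundary F m (part21 D) m0.
- by move=> a; apply: size_rVpoly.
- by move=> a b; rewrite /= Dlie rVpolyB !rVpoly_U.
have D21 a : (D (i1 a)).2 = star a 0 - U F m a (- poly_rV Q).
  rewrite linear0 sub0r actNr opprK; apply: (can_inj rVpolyK).
  by rewrite rVpoly_U poly_rV_K // -DQ.
pose d v := (D (i2 v)).2 - U F m (- b') v.
have dU a v : d (U F m a v) = U F m a (d v).
  rewrite /d /i2; have -> : (D (galilei_U (U F m a v))).2 =
      U F m (D (i1 a)).1 v + U F m a (D (galilei_U v)).2 by rewrite Der_sl2_U.
  rewrite D11 actBr act_lie.
  by apply/rowP => i; rewrite !mxE; ring.
(* Corrected by the inner part, the block on [U m] is equivariant. A vector vanishing at [r] lies in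
   the image of [sl2_nilp r], by [euler_surj], so its image does too and vanishes at [r]. *)
have [|c D22] := @galilei_scalar D (- b').
  move=> r v vr; rewrite -/(d v).
  have /factor_theorem[q vq] : root (rVpoly v) r by apply/eqP.
  have [R sR eR] : exists2 R : {poly F}, (size R <= m)%N & euler m r R = q.
    apply: euler_surj; have [->|q0] := eqVneq q 0; first by rewrite size_poly0.
    have := size_rVpoly v; rewrite vq size_Mmonic ?monicXsubC //.
    by rewrite size_XsubC addnS addn1.
  have -> : v = U F m (sl2_nilp r) (poly_rV R).
    apply: (can_inj rVpolyK); rewrite rVpoly_U poly_rV_K ?(leqW sR) //.
    rewrite vq -eR /dens quad_nilp dquad_nilp /euler; ring.
  by rewrite dU rVpoly_U horner_dens_nilp.
exists ((- b', c), (- poly_rV Q, 0)) => //.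
by apply: locder_map_intro => // v; exact: Der_galilei_U.
Qed.

Lemma DerP D : Der (galilei F m) D <->
  exists2 x : locder_model F m, x.2.2 = 0 & D = locder_map x.
Proof.
split=> [|[x x0 ->]]; [exact: Der_locder_map | exact: locder_map_Der].
Qed.

End DerClassification.

(** The centralizer of this nilpotent is the line it spans, so [quad b] is a multiple of
    [(X - r)^2]. *)
Lemma centralizer_sl2_nilp (F : numFieldType) (b : sl2 F) r :
  [lie b, sl2_nilp r] = 0 -> (quad b).[r] = 0 /\ (dquad b).[r] = 0.
Proof.
move=> e; have e1 := congr1 (fun x : sl2 F => x 0 1) e.
have e2 := congr1 (fun x : sl2 F => x 0 2%:R) e.
move: e1 e2; rewrite /= !mxE /= => e1 e2.
have /eqP : 2%:R * (b 0 2%:R + b 0 1 * r) = 0 by rewrite -[RHS]e1; ring.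
rewrite mulf_eq0 pnatr_eq0 addr_eq0 /= => /eqP b2.
have /eqP : b 0 0 + b 0 1 * r ^+ 2 = 0.
  by rewrite -[RHS]oppr0 -[X in - X]e2; ring.
rewrite addr_eq0 => /eqP b0.
by rewrite horner_quad horner_dquad b2 b0; split; ring.
Qed.

(** * Classification of the local derivations *)

Section LocDerClassification.
Variables (F : numFieldType) (m : nat).
Hypotheses (m_gt1 : (1 < m)%N) (m_odd : odd m).
Implicit Types (a b : sl2 F) (v P : 'rV[F]_m.+1) (w : 'rV[F]_(m - 2).+1).
Implicit Types D : 'End(galilei F m).

Lemma LocDer_locder_map D :
  LocDer (galilei F m) D -> exists x, D = locder_map x.
Proof.
move=> LD.
(* The parameters [b], [c], [P] depend on the point; the rest of the proof makes them uniform. *)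
have ex a v : exists b c P, D (a, v) =
    ([lie b, a], U F m b v - U F m a P + c *: v).
  have [D' /(Der_locder_map m_gt1 m_odd)[[[b c] [P w]] /= -> ->] ->] := LD (a, v).
  exists b, c, P; rewrite locder_mapE; congr pair.
  by rewrite /= linear0 addr0.
have D12 v : (D (galilei_U v)).1 = 0.
  by have [b [c [P ->]]] := ex 0 v; rewrite /= lie0r.
have [||P' [w [sP sw D11]]] := @decomp_vanishing F 2 (part11 D) isT.
- by move=> a; apply: size_quad.
- move=> r; have [b [c [P e]]] := ex (sl2_nilp r) 0.
  rewrite /= /galilei_sl2 e /= lie_anti linearN /= -dens2.
  by rewrite hornerN horner_dens_nilp oppr0.
have [b' defP] := quad_surj sP.
have {D11} D11 a : (D (galilei_sl2 m a)).1 = [lie - b', a] + w`_0 *: a.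
  apply: quad_inj; rewrite [LHS]D11 defP dens2 [quad a * w]mulrC.
  rewrite {1}(size1_polyC sw) mul_polyC [RHS]linearD linearZ /=.
  by rewrite lieNl.
(* For [m = 2] the third summand consists of scalars. It is excluded by testing on [h], since
   [[b, h]] never has a component along [h]. *)
have w0 : w`_0 = 0.
  have := D11 (sl2_h F); rewrite /galilei_sl2.
  have [b [c [P ->]]] := ex (sl2_h F) 0 => /(congr1 (fun x : sl2 F => x 0 2%:R)).
  rewrite /= !mxE /= => e.
  move/eqP: e; rewrite -subr_eq0 => /eqP e.
  by rewrite -[RHS]oppr0 -[X in - X]e; ring.
have {w0} D11' a : (D (galilei_sl2 m a)).1 = [lie - b', a].
  by rewrite D11 w0 scale0r addr0.
have [||Q [u [sQ su D21]]] := @decomp_vanishing F m (part21 D) (ltnW m_gt1).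
- by move=> a; apply: size_rVpoly.
- move=> r; have [b [c [P e]]] := ex (sl2_nilp r) 0.
  rewrite /= /galilei_sl2 e /= scaler0 addr0.
  rewrite rVpolyB linear0 linear0 sub0r hornerN -[U_act _ _]/(U F m _ _).
  by rewrite rVpoly_U horner_dens_nilp oppr0.
have [|c D22] := @galilei_scalar F m D (- b').
  move=> r v vr; have [b [c [P e]]] := ex (sl2_nilp r) v.
  have eU : (D (galilei_U v)).2 =
      (D (sl2_nilp r, v)).2 - (D (galilei_sl2 m (sl2_nilp r))).2.
    have -> : (D (sl2_nilp r, v)).2 =
        (D (galilei_sl2 m (sl2_nilp r))).2 + (D (galilei_U v)).2.
      by rewrite [in LHS]galilei_apply.
    by rewrite addrAC subrr add0r.
  (* At the point [(sl2_nilp r, v)] the local [b] and the global [- b'] have the same bracket with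
     [sl2_nilp r]. So their quadratics agree at [r], and the terms in the derivative of [v] cancel
     there. *)
  have [] := @centralizer_sl2_nilp F (b + b') r.
    have := congr1 fst e; rewrite galilei_apply /= D11' D12 addr0.
    by rewrite lieNl => E; rewrite lieDl -E lie_anti addNr.
  rewrite linearD hornerD => /eqP; rewrite addr_eq0 => /eqP qb _.
  have nQ : (rVpoly (D (galilei_sl2 m (sl2_nilp r))).2).[r] = 0.
    rewrite [rVpoly _]D21 hornerD hornerM horner_dens_nilp quad_nilp.
    by rewrite !(hornerE, horner_exp) subrr; ring.
  have -> : (D (galilei_U v)).2 - U F m (- b') v =
     U F m b v - U F m (sl2_nilp r) P + c *: v
     - (D (galilei_sl2 m (sl2_nilp r))).2 - U F m (- b') v by rewrite eU e.
  have evD (x y : 'rV[F]_m.+1) :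
      (rVpoly (x + y)).[r] = (rVpoly x).[r] + (rVpoly y).[r].
    by rewrite rVpolyD hornerD.
  have evN (x : 'rV[F]_m.+1) : (rVpoly (- x)).[r] = - (rVpoly x).[r].
    by rewrite linearN hornerN.
  rewrite !evD !evN nQ rVpolyZ hornerM vr !rVpoly_U horner_dens_nilp.
  rewrite !horner_dens vr qb linearN hornerN; ring.
exists ((- b', c), (- poly_rV Q, poly_rV u)).
apply: locder_map_intro => // a; apply: (can_inj rVpolyK).
rewrite [LHS]D21 rVpolyB rVpoly_star // actNr linearN /= opprK rVpoly_U.
rewrite !poly_rV_K //; first exact: addrC.
by rewrite -pred_subn2.
Qed.

(** For a kernel element, [b] is central in sl_2, hence zero; evaluation at [u_0] gives [c = 0];
    what is left on sl_2 falls under [decomp_inj]. *)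
Lemma locder_map_inj : injective (@locder_map F m).
Proof.
move=> x y /eqP; rewrite -subr_eq0.
have -> : locder_map x - locder_map y = locder_map (x - y).
  by rewrite -(linearB (linear_of (@locder_map_linear F m))).
move=> /eqP z; apply/eqP; rewrite -subr_eq0; apply/eqP.
case: (x - y) z => -[b c] [P w] z {x y}.
have za a v := congr1 (fun D : 'End(galilei F m) => D (a, v)) z.
have zb a : [lie b, a] = 0.
  by have /(congr1 fst) := za a 0; rewrite locder_mapE lfunE.
have b0 : b = 0.
  have := congr1 (fun x : sl2 F => (x 0 0, x 0 2%:R)) (zb (sl2_e F)).
  have := congr1 (fun x : sl2 F => x 0 0) (zb (sl2_h F)).
  rewrite /= !mxE /= => e0 [e2 e1].
  have /eqP : 2%:R * b 0 0 = 0 by rewrite -[RHS]oppr0 -[X in - X]e0; ring.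
  have /eqP : 2%:R * b 0 2%:R = 0 by rewrite -[RHS]e2; ring.
  have /eqP : b 0 1 = 0 by rewrite -[RHS]oppr0 -[X in - X]e1; ring.
  rewrite !mulf_eq0 pnatr_eq0 /= => /eqP b1 /eqP b2 /eqP b0.
  by rewrite (sl2_decomp b) b0 b1 b2 !scale0r !addr0.
have z2 a v : U F m b v - U F m a P + c *: v + star a w = 0.
  by have /(congr1 snd) := za a v; rewrite locder_mapE lfunE.
have c0 : c = 0.
  have := z2 0 (U_basis F m 0); rewrite b0 !act0l subr0 add0r.
  rewrite /star linear0 mul0r linear0 addr0.
  by move/(congr1 (fun x : 'rV[F]_m.+1 => x 0 0)); rewrite !mxE eqxx mulr1.
have [|_ P0 w0] := @decomp_inj F m 0 (- rVpoly P) (rVpoly w) (ltnW m_gt1).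
  move=> a; have /(congr1 rVpoly) := z2 a 0.
  rewrite act0r scaler0 sub0r addr0 rVpolyD rVpoly_star //.
  rewrite linearN /= rVpoly_U linear0.
  by rewrite /decomp /transv !deriv0 !mulr0 !subr0 add0r linearN.
rewrite b0 c0; congr (_, (_, _)).
  by apply: (can_inj rVpolyK); rewrite linear0 -[LHS]opprK P0 oppr0.
by apply: (can_inj rVpolyK); rewrite linear0.
Qed.

End LocDerClassification.

Lemma LocDerP (F : numClosedFieldType) m (D : 'End(galilei F m)) :
  (1 < m)%N -> odd m ->
  LocDer (galilei F m) D <-> exists x, D = locder_map x.
Proof.
move=> m1 om; split; first exact: LocDer_locder_map.
move=> [[[b c] [P w]] ->] [a v].
have sw := size_rVpoly_low m1 w.
have [Q sQ eQ] := quad_mul_in_dens a om sw.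
(* At the given [a] the term [star a w] equals the action of [a] on [Q], so it is absorbed into [P].
   Since [Q] depends on [a], so does the derivation. *)
exists (locder_map ((b, c), (P - poly_rV Q, 0))); first exact: locder_map_Der.
rewrite !locder_mapE; congr pair.
rewrite -[LHS]/(U F m b v - U F m a P + c *: v + star a w).
rewrite -[RHS]/(U F m b v - U F m a (P - poly_rV Q) + c *: v + star a 0).
have -> : star a w = U F m a (poly_rV Q).
  by apply: (can_inj rVpolyK); rewrite rVpoly_star // rVpoly_U poly_rV_K.
by rewrite linear0 actBr; apply/rowP => i; rewrite !mxE; ring.
Qed.

(** * The summand U_(m-2) and its independence of the decomposition *)

Section Summand.
Variables (F : numFieldType) (m : nat).
Hypothesis m_gt1 : (1 < m)%N.
Implicit Types (a b : sl2 F) (P : 'rV[F]_m.+1).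
Implicit Types (W : 'rV[F]_(m + 2).+1) (w : 'rV[F]_(m - 2).+1).

Lemma dens_lie a b (P : {poly F}) : (size P <= m.+1)%N ->
  dens m b (dens m a P) - dens m [lie b, a] P = dens m a (dens m b P).
Proof.
move=> /poly_rV_K <-; rewrite -!rVpoly_U -rVpolyB act_lie; congr rVpoly.
by apply/rowP => i; rewrite !mxE; ring.
Qed.

Lemma densD n a (P Q : {poly F}) : dens n a (P + Q) = dens n a P + dens n a Q.
Proof. exact: linearD. Qed.

Definition decomp_row (x : 'rV[F]_(m + 2).+1 * 'rV[F]_m.+1 * 'rV[F]_(m - 2).+1) a
    : 'rV[F]_m.+1 :=
  poly_rV (decomp m (rVpoly x.1.1) (rVpoly x.1.2) (rVpoly x.2) a).

Lemma size_rVpoly_top W : (size (rVpoly W) <= m.+3)%N.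
Proof. by rewrite (leq_trans (size_rVpoly _)) // addn2. Qed.

Lemma rVpoly_decomp x a : rVpoly (decomp_row x a) =
  decomp m (rVpoly x.1.1) (rVpoly x.1.2) (rVpoly x.2) a.
Proof.
by rewrite poly_rV_K // size_decomp ?size_rVpoly_top ?size_rVpoly_low ?size_rVpoly.
Qed.

Fact decomp_row_linear x : linear (decomp_row x).
Proof. by move=> c a b; rewrite /decomp_row linearP linearP. Qed.

Definition decomp_hom x : 'Hom(sl2 F, 'rV[F]_m.+1) :=
  linfun (linear_of (decomp_row_linear x)).

Lemma decomp_homE x a : decomp_hom x a = decomp_row x a.
Proof. exact: lfunE. Qed.

Fact decomp_hom_linear : linear decomp_hom.
Proof.
move=> c [[W P] w] [[W' P'] w']; apply/lfunP => a.
rewrite add_lfunE scale_lfunE !decomp_homE /decomp_row /= -linearP; congr poly_rV.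
rewrite 3!linearP /= /decomp /transv /dens !(derivD, derivZ) -!mul_polyC; ring.
Qed.

HB.instance Definition _ :=
  GRing.isLinear.Build F _ _ *:%R decomp_hom decomp_hom_linear.

Lemma decomp_homB x y : decomp_hom (x - y) = decomp_hom x - decomp_hom y.
Proof. exact: linearB. Qed.

Definition decomp_map := linfun decomp_hom.

Lemma decomp_mapE x : decomp_map x = decomp_hom x.
Proof. exact: lfunE. Qed.

(** Equivariance is checked summand by summand, with [dens_transv], [dens_lie] and [dens_quad_mul];
    bijectivity comes from [decomp_inj] and [decomp_surj]. *)
Lemma decomp_map_decomposition : hom_decomposition decomp_map.
Proof.
split=> [x [[W P] w]|].
  rewrite !decomp_mapE; apply/lfunP => a; rewrite [RHS]hom_actE !decomp_homE.
  apply: (can_inj rVpolyK); rewrite rVpolyB rVpoly_U !rVpoly_decomp.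
  rewrite -[LHS]/(decomp m (rVpoly (U F (m + 2) x W)) (rVpoly (U F m x P))
    (rVpoly (U F (m - 2) x w)) a) !rVpoly_U -[RHS]/(
    dens m x (transv m a (rVpoly W) + dens m a (rVpoly P) + quad a * rVpoly w)
    - (transv m [lie x, a] (rVpoly W) + dens m [lie x, a] (rVpoly P)
       + quad [lie x, a] * rVpoly w)) /decomp.
  rewrite [X in dens X x (rVpoly W)]addn2 -dens_transv -dens_lie ?size_rVpoly //.
  rewrite -dens_quad_mul -[X in dens X x (quad a * _)]addn2 subnK //.
  have shuffle (A B C A' B' C' : {poly F}) :
    A - A' + (B - B') + (C - C') = A + B + C - (A' + B' + C') by ring.
  by rewrite !densD; exact: shuffle.
have inj x : decomp_hom x = 0 -> x = 0.
  case: x => [[W P] w] x0.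
  have [|W0 P0 w0] := @decomp_inj F m (rVpoly W) (rVpoly P) (rVpoly w) (ltnW m_gt1).
    by move=> a; rewrite -(rVpoly_decomp (W, P, w)) -decomp_homE x0 lfunE /= linear0.
  by congr (_, _, _); apply: (can_inj rVpolyK); rewrite linear0.
have surj f : exists x, decomp_hom x = f.
  pose G : {linear sl2 F -> {poly F}} := rVpoly \o f.
  have [W [P [w [sW sP sw GE]]]] :=
    @decomp_surj F m G (ltnW m_gt1) (fun a => size_rVpoly _).
  have {}sW : (size W <= (m + 2).+1)%N by rewrite addn2.
  have {}sw : (size w <= (m - 2).+1)%N by rewrite -pred_subn2.
  exists (poly_rV W, poly_rV P, poly_rV w); apply/lfunP => a.
  by apply: (can_inj rVpolyK); rewrite decomp_homE rVpoly_decomp !poly_rV_K -?GE.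
have [inv invK] := choice surj.
exists inv => [x|f]; rewrite decomp_mapE; last exact: invK.
apply: subr0_eq; apply: inj.
by rewrite decomp_homB invK subrr.
Qed.

Definition star_hom w : 'Hom(sl2 F, 'rV[F]_m.+1) :=
  linfun (linear_of (@star_linearl F m w)).

Lemma star_homE w a : star_hom w a = star a w.
Proof. exact: lfunE. Qed.

Lemma hom_summand_star w : hom_summand F m (star_hom w).
Proof.
exists decomp_map; first exact: decomp_map_decomposition.
exists w; rewrite decomp_mapE; apply/lfunP => a; rewrite star_homE decomp_homE.
apply: (can_inj rVpolyK); rewrite rVpoly_decomp rVpoly_star // !linear0.
by rewrite /decomp /dens /transv !deriv0 !mulr0 !subr0 !add0r.
Qed.

(** [Phi (0, 0, u_0)] is a highest weight vector of weight [m - 2], which determines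
    it up to a scalar; [f] then propagates the equality to every [u_k]. *)
Lemma hom_decomposition_star Phi : hom_decomposition Phi ->
  exists c, forall w, Phi (0, 0, w) = star_hom (c *: w).
Proof.
move=> [hPhi _]; pose g w := Phi (0, 0, w).
have g_linear : linear g.
  move=> c w w'; rewrite /g -linearP -[X in _ = Phi X]/(_, _, c *: w + w').
  by rewrite /= !scaler0 !addr0.
have gact x w y : rVpoly (g (U F (m - 2) x w) y) =
    dens m x (rVpoly (g w y)) - rVpoly (g w [lie x, y]).
  rewrite -rVpoly_U -rVpolyB -hom_actE -[hom_act _ _ _]/(hom_module _ x (g w)) -hPhi.
  by rewrite /g; congr (rVpoly (Phi (_, _, _) _)); rewrite act0r.
have gz : g 0 = 0 by exact: linear0.
have gZ c w : g (c *: w) = c *: g w by rewrite -[c *: w]addr0 g_linear gz addr0.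
pose u k := U_basis F (m - 2) k; pose n := (m - 2)%N.
have mn : m%:R = n%:R + 2%:R :> {poly F} by rewrite -natrD subnK.
pose E := rVpoly (g (u 0) (sl2_e F)); pose H := rVpoly (g (u 0) (sl2_h F)).
pose K := rVpoly (g (u 0) (sl2_f F)).
have ge y : (rVpoly (g (u 0) y))^`() = rVpoly (g (u 0) [lie sl2_e F, y]).
  have := gact (sl2_e F) (u 0) y; rewrite U_e // scale0r.
  rewrite gz lfunE /= linear0 /dens quad_e dquad_e => /eqP.
  by rewrite mulr0 mul0r subr0 mul1r eq_sym subr_eq0 => /eqP.
have gh y : n%:R * rVpoly (g (u 0) y) =
    dens m (sl2_h F) (rVpoly (g (u 0) y)) - rVpoly (g (u 0) [lie sl2_h F, y]).
  rewrite -gact U_h // -/n mulr0 subr0.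
  by rewrite gZ scale_lfunE rVpolyZ polyC_natr.
have E' : E^`() = 0 by rewrite ge liexx !linear0.
have H' : H^`() = - (2%:R * E).
  by rewrite ge lie_anti sl2_he !linearN !linearZ /= -mul_polyC polyC_natr mulrN.
have K' : K^`() = H by rewrite ge sl2_ef.
have natrK k (p : {poly F}) : k.+1%:R * p = 0 -> p = 0.
  move/eqP; rewrite -polyC_natr mulf_eq0 polyC_eq0 pnatr_eq0 /=; exact: eqP.
(* As m = n + 2, the weight equation at [h] leaves [2 H = - 4 X E]; the one at [f] similarly leaves
   [4 K = - 4 X^2 E]. *)
have HE : H = - (2%:R * 'X) * E.
  have := gh (sl2_h F); rewrite liexx 2!linear0 subr0 -/H /dens quad_h dquad_h mn H'.
  move=> /eqP; rewrite -subr_eq0 => /eqP e.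
  apply/eqP; rewrite -subr_eq0; apply/eqP/(natrK 1).
  by rewrite -[RHS]oppr0 -[in RHS]e; ring.
have KE : K = - 'X^2 * E.
  have := gh (sl2_f F); rewrite sl2_hf linearN linearN linearZ linearZ /=.
  rewrite -mul_polyC polyC_natr -/K /dens quad_h dquad_h mn K' HE.
  move=> /eqP; rewrite -subr_eq0 => /eqP e.
  apply/eqP; rewrite -subr_eq0; apply/eqP/(natrK 3).
  by rewrite -[RHS]oppr0 -[in RHS]e; ring.
have EC : E = (E`_0)%:P.
  apply: size1_polyC; apply/leq_sizeP => -[|j] // _.
  have /eqP := congr1 (fun p : {poly F} => p`_j) E'.
  by rewrite coef_deriv coef0 -mulr_natr mulf_eq0 pnatr_eq0 orbF => /eqP.
have g0 y : g (u 0) y = E`_0 *: star y (u 0).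
  apply: (can_inj rVpolyK).
  rewrite rVpolyZ rVpoly_star // rVpoly_U_basis // expr0 mulr1 -EC.
  pose f1 : {linear sl2 F -> {poly F}} := rVpoly \o g (u 0).
  have -> : E * quad y = decomp m 0 0 E y.
    by rewrite /decomp /transv /dens !deriv0 !mulr0 !subr0 !add0r mulrC.
  apply: (@eq_on_sl2 _ _ f1 (decomp m 0 0 E)) y; rewrite /f1 /= -/E -/H -/K.
  - by rewrite decomp_e !deriv0 !add0r.
  - by rewrite decomp_f !deriv0 KE; ring.
  - by rewrite decomp_h !deriv0 HE; ring.
exists E`_0 => w; apply/lfunP => y; rewrite star_homE starZ.
move: y; suff gk k : (k <= n)%N -> forall y, g (u k) y = E`_0 *: star y (u k).
  move=> y; have gy_linear : linear (fun w' => g w' y).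
    by move=> c w1 w2; rewrite g_linear add_lfunE scale_lfunE.
  exact: (eq_on_U_basis (f := linear_of gy_linear) (g := E`_0 \*: star y))
    (fun k kn => gk k kn y) w.
elim: k => [//|k IHk] kn y; have {}IHk := IHk (ltnW kn).
apply: (can_inj rVpolyK); apply/eqP; rewrite -subr_eq0 -linearB; apply/eqP.
apply: (natrK (n - k.+1)%N); rewrite subnSK // -polyC_natr -rVpolyZ.
apply/eqP; rewrite scalerBr rVpolyB subr_eq0; apply/eqP.
have -> : (n - k)%:R *: g (u k.+1) y = g (U F (m - 2) (sl2_f F) (u k)) y.
  by rewrite U_f ?(ltnW kn) // gZ scale_lfunE.
rewrite gact !IHk -rVpoly_U -rVpolyB; congr rVpoly.
have Ef : (n - k)%:R *: u k.+1 = U F (m - 2) (sl2_f F) (u k).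
  by rewrite U_f ?(ltnW kn).
rewrite [RHS]scalerA [_ * E`_0]mulrC -[RHS]scalerA -(starZ _ (n - k)%:R) Ef.
by rewrite star_act // scalerBr actZr.
Qed.

End Summand.

(** Any decomposition yields only multiples [star_hom (c *: w)], and the explicit [decomp_map]
    yields every [star_hom w]. *)
Lemma calPP (F : numFieldType) m (f : 'End(galilei F m)) : (1 < m)%N ->
  calP F m f <-> exists w, f = locder_map ((0, 0), (0, w)).
Proof.
move=> m1; have ext w : extend_by_zero (U F m) (star_hom w) =
    locder_map ((0, 0), (0, w)) :> 'End(galilei F m).
  apply/lfunP => p; rewrite extend_by_zeroE locder_mapE star_homE; congr pair.
    by rewrite [RHS]lie0l.
  rewrite -[RHS]/(U F m 0 p.2 - U F m p.1 0 + 0 *: p.2 + star p.1 w).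
  by rewrite act0l act0r scale0r subr0 !add0r.
split=> [[f0 [Phi dPhi [w ->]] <-]|[w ->]].
  by have [c ->] := hom_decomposition_star m1 dPhi; exists (c *: w); rewrite ext.
by exists (star_hom w); rewrite ?ext //; exact: hom_summand_star.
Qed.

(** * Transport of the Lie structure from the model *)

Section Structure.
Variables (F : numClosedFieldType) (m : nat).
Hypotheses (m_gt1 : (1 < m)%N) (m_odd : odd m).
Implicit Types (x y : locder_model F m) (w : 'rV[F]_(m - 2).+1).

Definition locder_low w : locder_model F m := ((0, 0), (0, w)).

Lemma locder_low_linear : linear locder_low.
Proof.
move=> c w w'.
rewrite -[RHS]/((c *: 0 + 0, c *: 0 + 0), (c *: 0 + 0, c *: w + w')).
by rewrite !scaler0 !addr0.
Qed.

(** The source of three facts: the ideal property, commutativity (take the sl_2 and [d0] components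
    zero), and the module structure of [calP]. *)
Lemma lie_locder_low x w :
  [lie x, locder_low w] = locder_low (U F (m - 2) x.1.1 w + x.1.2 *: w).
Proof.
case: x => -[b c] [P w'].
rewrite -[LHS]/(([lie b, 0], 0), (U F m b 0 + c *: 0 - (U F m 0 P + 0 *: P),
  U F (m - 2) b w + c *: w - (U F (m - 2) 0 w' + 0 *: w'))).
by rewrite lie0r act0r scaler0 !act0l !scale0r !addr0 !subr0.
Qed.

Lemma lie_low0 x y : x.2.2 = 0 -> y.2.2 = 0 -> [lie x, y].2.2 = 0.
Proof.
case: x y => -[b c] [P w] [[b' c'] [P' w']] /= -> ->.
rewrite -[LHS]/(U F (m - 2) b 0 + c *: 0 - (U F (m - 2) b' 0 + c' *: 0)).
by rewrite !act0r !scaler0 !addr0 subr0.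
Qed.

Lemma locder_map_sl2 (a : sl2 F) :
  locder_map ((a, 0), (0, 0)) = ad (galilei_sl2 m a).
Proof.
apply/lfunP => p; rewrite locder_mapE (adE (galilei_sl2 m a)) galilei_lie.
rewrite -[LHS]/([lie a, p.1],
  U F m a p.2 - U F m p.1 0 + 0 *: p.2 + star p.1 0).
have -> : star p.1 (0 : 'rV_(m - 2).+1) = 0 :> 'rV[F]_m.+1 by exact: linear0.
by rewrite scale0r !addr0.
Qed.

Let phi : locder_model F m -> gl (galilei F m) := @locder_map F m.

Let phiP c x y : phi (c *: x + y) = c *: phi x + phi y.
Proof. exact: locder_map_linear. Qed.

Let phi0 : phi 0 = 0.
Proof. by have := phiP (-1) 0 0; rewrite scaler0 addr0 scaleN1r addNr. Qed.

Let phiD x y : phi (x + y) = phi x + phi y.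
Proof. by have := phiP 1 x y; rewrite !scale1r. Qed.

Let LP D : LocDer (galilei F m) D <-> exists x, D = phi x.
Proof. exact: LocDerP. Qed.

Let DP D : Der (galilei F m) D <->
  exists2 x : locder_model F m, x.2.2 = 0 & D = phi x.
Proof. exact: DerP. Qed.

Let CP D : calP F m D <-> exists w, D = phi (locder_low w).
Proof. exact: calPP. Qed.

Let phi_lie x y : phi [lie x, y] = [lie phi x, phi y].
Proof. exact: locder_map_lie. Qed.

Let phi_inj x y : phi x = phi y -> x = y.
Proof. exact: locder_map_inj. Qed.

Let low0 : locder_low 0 = 0. Proof. by []. Qed.

Lemma LocDer_subalgebra : lie_subalgebra (LocDer (galilei F m)).
Proof.
split; first split.
- by apply/LP; exists 0; rewrite phi0.
- move=> c _ _ /LP[x ->] /LP[y ->]; apply/LP.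
  by exists (c *: x + y); rewrite phiP.
- by move=> _ _ /LP[x ->] /LP[y ->]; apply/LP; exists [lie x, y]; rewrite phi_lie.
Qed.

Lemma Der_subalgebra : lie_subalgebra (Der (galilei F m)).
Proof.
split; first split.
- by apply/DP; exists 0; rewrite ?phi0.
- move=> c _ _ /DP[x x0 ->] /DP[y y0 ->]; apply/DP.
  exists (c *: x + y); last by rewrite phiP.
  by rewrite -[LHS]/(c *: x.2.2 + y.2.2) x0 y0 scaler0 addr0.
- move=> _ _ /DP[x x0 ->] /DP[y y0 ->]; apply/DP.
  by exists [lie x, y]; [exact: lie_low0 | rewrite phi_lie].
Qed.

Lemma calP_ideal : lie_ideal (LocDer (galilei F m)) (calP F m).
Proof.
split.
- split; first by apply/CP; exists 0; rewrite low0 phi0.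
  move=> c _ _ /CP[w ->] /CP[w' ->]; apply/CP.
  by exists (c *: w + w'); rewrite locder_low_linear phiP.
- by move=> _ /CP[w ->]; apply/LP; exists (locder_low w).
- move=> _ _ /LP[x ->] /CP[w ->]; apply/CP.
  by exists (U F (m - 2) x.1.1 w + x.1.2 *: w); rewrite -lie_locder_low phi_lie.
Qed.

Lemma LocDer_semidirect :
  internal_semidirect (LocDer (galilei F m)) (Der (galilei F m)) (calP F m).
Proof.
split; [exact: LocDer_subalgebra | exact: Der_subalgebra | exact: calP_ideal | |].
- apply/seteqP; split=> [D [/DP[x x0 ->] /CP[w /phi_inj xw]]|_ ->].
    by move: x0; rewrite xw /= => ->; rewrite low0 phi0.
  split; first by apply/DP; exists 0; rewrite ?phi0.
  by apply/CP; exists 0; rewrite low0 phi0.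
- apply/seteqP; split=> [_ /LP[x ->]|_ [_ /DP[x _ ->] [_ /CP[w ->] <-]]].
    case: x => bc [P w].
    exists (phi (bc, (P, 0))); first by apply/DP; exists (bc, (P, 0)).
    exists (phi (locder_low w)); first by apply/CP; exists w.
    rewrite -phiD; congr phi; case: bc => b c.
    rewrite -[LHS]/((b + 0, c + 0), (P + 0, 0 + w)).
    by rewrite !addr0 add0r.
  by apply/LP; exists (x + locder_low w); rewrite phiD.
Qed.

Lemma calP_commutative : lie_commutative (calP F m).
Proof.
move=> _ _ /CP[w ->] /CP[w' ->]; rewrite -phi_lie lie_locder_low.
by rewrite act0l scale0r addr0 low0 phi0.
Qed.

Lemma calP_isomorphic : sl2_isomorphic (U F (m - 2)) (calP F m).
Proof.
have psi_linear : linear (fun w => phi (locder_low w)).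
  by move=> c w w'; rewrite locder_low_linear phiP.
pose psi := linfun (linear_of psi_linear).
have psiE w : psi w = phi (locder_low w) by rewrite lfunE.
exists psi; split=> [w w'||a w].
- by rewrite !psiE => /phi_inj [].
- apply/seteqP; split=> [_ [w _ <-]|_ /CP[w ->]].
    by apply/CP; exists w; rewrite psiE.
  by exists w => //; rewrite psiE.
- rewrite !psiE -locder_map_sl2 -[locder_map _]/(phi _) -phi_lie lie_locder_low.
  by rewrite scale0r addr0.
Qed.

Lemma LocDer_isomorphic : lie_isomorphic (locder_model F m) (LocDer (galilei F m)).
Proof.
pose psi := linfun (linear_of (@locder_map_linear F m)).
have psiE x : psi x = phi x by rewrite lfunE.
exists psi; split=> [x y||x y].
- by rewrite !psiE => /phi_inj.
- apply/seteqP; split=> [_ [x _ <-]|_ /LP[x ->]].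
    by apply/LP; exists x; rewrite psiE.
  by exists x => //; rewrite psiE.
- by rewrite !psiE phi_lie.
Qed.

End Structure.

Theorem theorem5p2 (R : realType) (m : nat) (m_ge3 : (3 <= m)%N) (m_odd : odd m) :
  [/\ lie_subalgebra (LocDer (galilei R[i] m)),
      internal_semidirect (LocDer (galilei R[i] m))
        (Der (galilei R[i] m)) (calP R[i] m),
      lie_commutative (calP R[i] m),
      sl2_isomorphic (U R[i] (m - 2)) (calP R[i] m)
    & lie_isomorphic (locder_model R[i] m) (LocDer (galilei R[i] m))].
Proof.
have m1 : (1 < m)%N := ltnW m_ge3.
split.
- exact: LocDer_subalgebra.
- exact: LocDer_semidirect.
- exact: calP_commutative.
- exact: calP_isomorphic.
- exact: LocDer_isomorphic.
Qed.
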